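(* For the mixed site-bond Bernoulli percolation on the square lattice $\mathbb{L}^2$, with bond parameter $b$, it holds that $$s_{\mathrm{c}}(b)\le \exp\left(-\frac{2}{3}\left(b-\frac{1}{2}+\frac{1}{3}\log\frac{8-6b}{5}\right)\right),$$ where $s_{\mathrm{c}}(b)=\inf\{s\in[0,1]:\lim_{n\to\infty}\theta_n(s,b)>0\}$.
   Context: $\mathbb{L}^2=(\mathbb{Z}^2,\mathbb{E}^2)$ is the square lattice, with $\mathbb{E}^2=\{uv:u,v\in\mathbb{Z}^2,\ \|u-v\|_1=1\}$. In mixed site-bond Bernoulli percolation with parameters $s,b\in[0,1]$, all sites and bonds are independently declared open or closed, each site being open with probability $s$ and each bond with probability $b$; the law on $\{0,1\}^{\mathbb{Z}^2\cup\mathbb{E}^2}$ is denoted $P_{s,b}$. For $n\ge0$ let $B_n=\{x\in\mathbb{Z}^2:\|x\|_1\le n\}$ and $\partial B_n=\{x\in\mathbb{Z}^2:\|x\|_1=n\}$. For $A\subset\mathbb{Z}^2$, $(0\leftrightarrow A)$ is the event that there is a lattice path $(x_0,x_1,\dots,x_{k+1})$ with $x_0=0$, $x_{k+1}\in A$, such that the site $x_i$ is open for all $i\in\{1,\dots,k\}$ and the bond $x_ix_{i+1}$ is open for all $i\in\{0,\dots,k\}$ (the end-sites $x_0$ and $x_{k+1}$ are not required to be open). Set $\theta_n(s,b)=P_{s,b}(0\leftrightarrow\partial B_{n+1})$. The infimum defining $s_{\mathrm{c}}(b)$ is taken within $[0,1]$, so that it equals $1$ if the set is empty; in particular $s_{\mathrm{c}}(1/2)=1$.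 Here $\log$ is the natural logarithm. *)

(* Defs.v *)
From HB Require Import structures.
From mathcomp Require Import all_boot all_order all_algebra finmap.
From mathcomp Require Import all_classical all_reals all_analysis.

Set Implicit Arguments.
Unset Strict Implicit.
Unset Printing Implicit Defensive.

Import Order.TTheory GRing.Theory Num.Theory.
Import numFieldNormedType.Exports.

Local Open Scope classical_set_scope.
Local Open Scope ring_scope.

Definition site : Type := (int * int)%type.

Definition norm1 (x : site) : nat := (`|x.1| + `|x.2|)%N.

(* Bonds are unordered pairs of sites. *)
Definition is_bond (e : {fset site}) : bool :=
  `[< exists u v : site, e = [fset u; v]%fset /\ norm1 (u - v) = 1%N >].

Definition bond : Type := {e : {fset site} | is_bond e}.

Definition element : Type := (site + bond)%type.

Definition coordinate_events : set (set (element -> bool)) :=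
  range (fun a : element => [set w | w a = true]).

(* The space {0,1}^(Z^2 \cup E^2) with its product sigma-algebra;
   true means open. *)
Definition configuration := g_sigma_algebraType coordinate_events.

Definition site_open (w : configuration) (x : site) : Prop := w (inl x) = true.

Definition bond_open (w : configuration) (x y : site) : Prop :=
  exists e : bond, val e = [fset x; y]%fset /\ w (inr e) = true.

Section MixedPercolation.
Variable R : realType.

Definition open_prob (s b : R) (a : element) : R :=
  match a with inl _ => s | inr _ => b end.

(* [mu] is the product measure P_{s,b}: this gives its values on all finite
   cylinders, hence characterizes it among probability measures. *)
Definition is_mixed_bernoulli (s b : R) (mu : probability configuration R) :
    Prop :=
  forall (J : {fset element}) (c : element -> bool),
    mu [set w : configuration | forall a, a \in J -> w a = c a] =
    (\prod_(a <- J)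
       (if c a then open_prob s b a else 1 - open_prob s b a))%:E.

Definition connected_to (A : set site) : set configuration :=
  [set w | exists (k : nat) (x : nat -> site),
     [/\ x 0%N = 0, A (x k.+1),
         (forall i, (1 <= i <= k)%N -> site_open w (x i)) &
         (forall i, (i <= k)%N -> bond_open w (x i) (x i.+1))]].

Definition sphere (n : nat) : set site := [set x | norm1 x = n].

Definition theta (mu : probability configuration R) (n : nat) : R :=
  fine (mu (connected_to (sphere n.+1))).

Definition supercritical (P : R -> R -> probability configuration R) (b : R) :
    set R :=
  [set s | 0 <= s <= 1 /\ 0 < limn (theta (P s b))].

(* [inf set0] is 0 in the library, whereas the infimum within [0, 1] of the
   empty set is 1. *)
Definition s_c (P : R -> R -> probability configuration R) (b : R) : R :=
  if `[< supercritical P b = set0 >] then 1 else inf (supercritical P b).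

End MixedPercolation.

(* Main.v *)
(* Bond percolation: if the expected number phi(S) of open exits of the cluster
   of the origin inside a finite set S were < 1 for some S at a parameter
   t >= 1/2, arms would decay exponentially (Duminil-Copin and Tassion), whereas
   self-duality gives crossings of (n+1) x n rectangles probability >= 1/2. So
   phi(S) >= 1 for all S, and conditioning on the set blocked from the sphere
   turns this into the differential inequality t (1 - t) F' >= 1 - F for the arm
   probability F, whence F(b0) >= 1 - 1 / (2 b0) uniformly in the radius.

   Mixed percolation: an open pivotal site with an open pivotal incident bond is
   charged to that bond; without one, all its four bonds are open, and closing
   any one of them creates an open pivotal incident bond. Hence
   2 (1 - b) s (d theta / d s) <= (4 - 3 b) (d theta / d b), so theta is
   nondecreasing along the curve s' = - s 2 (1 - b) / (4 - 3 b) issued from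
   (s, b) = (1, b0). Let b0 decrease to 1/2. *)
Require Import Defs.
From mathcomp Require Import all_boot all_order all_algebra finmap.
From mathcomp Require Import all_classical all_reals all_analysis.
From mathcomp Require Import ring lra zify.

Set Implicit Arguments.
Unset Strict Implicit.
Unset Printing Implicit Defensive.

Import Order.TTheory GRing.Theory Num.Theory.
Import numFieldNormedType.Exports.
Local Open Scope ring_scope.

(** * Averages over finitely many coordinates *)

(** Every probability is a finite average [avg], polynomial in the weights, so that independence,
    Russo's formula and monotonicity in the parameters are inductions on a list of coordinates. The
    given measure enters only through [theta_avg].

    Duality uses no planar topology. If both the crossing and the dual crossing failed, the
    indicators of being joined to the left side in the two configurations would contradict a
    summation by parts: a bond or its dual is open, and the matching indicator is constant along it.

    Two explorations have opposite purposes. The cluster of the origin in S is found without looking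
    at bonds off the cluster, which leaves the rest of an arm fresh; the set blocked from the sphere
    is found from outside, which leaves the bonds inside it fresh.

    To integrate the differential inequality, the factor 1 - t is given up: t (1 - F) is then
    nonincreasing, and it is at most 1/2 at t = 1/2. The resulting bound is 0 at b0 = 1/2, so the
    curve has to start strictly above 1/2, and the critical bound is only reached in the limit. *)

Section Update.
Variable T : eqType.
Implicit Types (w : T -> bool) (a b : T).

Definition upd w a v : T -> bool := fun x => if x == a then v else w x.

Lemma upd_same w a v : upd w a v a = v.
Proof. by rewrite /upd eqxx. Qed.

Lemma upd_other w a v x : x != a -> upd w a v x = w x.
Proof. by rewrite /upd => /negPf ->. Qed.

Lemma updC w a b u v : a != b -> upd (upd w a u) b v = upd (upd w b v) a u.
Proof.
by move=> ab; apply/funext => x; rewrite /upd; have [->|//] := eqVneq x b;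
  rewrite eq_sym (negPf ab).
Qed.

Lemma upd_upd w a u v : upd (upd w a u) a v = upd w a v.
Proof. by apply/funext => x; rewrite /upd; case: eqP. Qed.

Lemma upd_id w a : upd w a (w a) = w.
Proof. by apply/funext => x; rewrite /upd; case: eqP => // ->. Qed.

Lemma upd_idv w a v : w a = v -> upd w a v = w.
Proof. by move=> <-; exact: upd_id. Qed.

End Update.

Section Expectation.
Variables (R : realFieldType) (T : eqType).
Implicit Types (p : T -> R) (w : T -> bool) (f g : (T -> bool) -> R).
Implicit Types (J : seq T) (a b : T).

Definition avg1 p a f w : R :=
  p a * f (upd w a true) + (1 - p a) * f (upd w a false).

(** Coordinates outside [J] stay frozen at [w], as in a conditional expectation. Averaging twice
    over a coordinate changes nothing, so repetitions in [J] are harmless. *)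
Definition avg p J f : (T -> bool) -> R := foldr (avg1 p) f J.

Definition prob_weights p := forall a, 0 <= p a <= 1.

Definition indep_of a f := forall w v, f (upd w a v) = f w.

Definition supported (J : seq T) f :=
  forall w w', {in J, w =1 w'} -> f w = f w'.

Definition delta a f w := f (upd w a true) - f (upd w a false).

Lemma epsC p a b f : avg1 p a (avg1 p b f) = avg1 p b (avg1 p a f).
Proof.
have [->//|ab] := eqVneq a b.
apply/funext => w; rewrite /avg1 !(@updC _ w b a) 1?eq_sym //; ring.
Qed.

Lemma eps_indep p a f : indep_of a f -> avg1 p a f = f.
Proof. by move=> fa; apply/funext => w; rewrite /avg1 !fa; ring. Qed.

Lemma indep_eps_same p a f : indep_of a (avg1 p a f).
Proof. by move=> w v; rewrite /avg1 !upd_upd. Qed.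

Lemma indep_eps p a b f : indep_of a f -> indep_of a (avg1 p b f).
Proof.
have [<- _|ab fa w v] := eqVneq a b; first exact: indep_eps_same.
by rewrite /avg1 !(@updC _ w a b) // !fa.
Qed.

Lemma indep_avg p J a f : indep_of a f -> indep_of a (avg p J f).
Proof. by move=> fa; elim: J => //= b J IH; apply: indep_eps. Qed.

Lemma indep_delta a f : indep_of a (delta a f).
Proof. by move=> w v; rewrite /delta !upd_upd. Qed.

Lemma avg_eps p J a f : avg p J (avg1 p a f) = avg1 p a (avg p J f).
Proof. by elim: J => //= b J ->; rewrite epsC. Qed.

Lemma avgC p J J' f : avg p J (avg p J' f) = avg p J' (avg p J f).
Proof. by elim: J => //= b J ->; rewrite avg_eps. Qed.

Lemma avg_absorb p J a f : a \in J -> avg p J (avg1 p a f) = avg p J f.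
Proof.
elim: J => //= b J IH; rewrite in_cons => /orP[/eqP->|/IH ->//].
by rewrite avg_eps (eps_indep _ (@indep_eps_same _ _ _)).
Qed.

Lemma supportedS J J' f : {subset J <= J'} -> supported J f -> supported J' f.
Proof. by move=> JJ' fJ w w' ww'; apply: fJ => a /JJ'; exact: ww'. Qed.

Lemma avg_supported_const p J f w w' : supported J f -> avg p J f w = avg p J f w'.
Proof.
move=> fJ; suff H : forall J1 u u', {in J, forall a, a \notin J1 -> u a = u' a} ->
    avg p J1 f u = avg p J1 f u' by apply: H => a ->.
elim=> [|b J1 IH] u u' uu' /=.
  by apply: fJ => a aJ; apply: uu'.
rewrite /avg1; congr (_ * _ + _ * _); apply: IH => a aJ aJ1; rewrite /upd;
 case: eqP => // /eqP ab; apply: uu' => //; by rewrite in_cons negb_or ab.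
Qed.

Lemma avg_indep_id p J f : (forall a, a \in J -> indep_of a f) -> avg p J f = f.
Proof.
elim: J => //= a J IH fJ; rewrite IH; last by move=> b bJ; apply: fJ; rewrite inE bJ orbT.
by apply: eps_indep; apply: fJ; rewrite inE eqxx.
Qed.

(** Either average is a constant function, which further averaging leaves alone; both therefore
    equal the average over the two lists in succession, whose order is immaterial. *)
Lemma avg_supported p J J' f w w' : supported J f -> supported J' f ->
  avg p J f w = avg p J' f w'.
Proof.
move=> fJ fJ'; rewrite (avg_supported_const p w' w fJ').
have c (K : seq T) : supported K f -> forall K', avg p K' (avg p K f) = avg p K f.
  move=> fK K'; apply: avg_indep_id => a _ u v; exact: avg_supported_const.
by rewrite -(c J fJ J') avgC c.
Qed.

Lemma avg_ext p p' J f w : {in J, p =1 p'} -> avg p J f w = avg p' J f w.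
Proof.
elim: J w => //= a J IH w pp'; rewrite /avg1 pp' ?inE ?eqxx // !IH // => b bJ;
by apply: pp'; rewrite inE bJ orbT.
Qed.

(** The invariant has to survive only updates of nonzero weight. With site weight 1 this confines a
    comparison to configurations in which all sites are open. *)
Lemma avg_le_inv p J f g w (I : (T -> bool) -> Prop) : prob_weights p ->
  (forall a u, I u -> p a != 0 -> I (upd u a true)) ->
  (forall a u, I u -> p a != 1 -> I (upd u a false)) ->
  (forall u, I u -> f u <= g u) -> I w -> avg p J f w <= avg p J g w.
Proof.
move=> pp It If fg; elim: J w => [|a J IH] w Iw /=; first exact: fg.
have /andP[p0 p1] := pp a; apply: lerD.
  have [->|pa] := eqVneq (p a) 0; first by rewrite !mul0r.
  by apply: ler_wpM2l => //; apply: IH; apply: It.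
have [->|pa] := eqVneq (p a) 1; first by rewrite subrr !mul0r.
by apply: ler_wpM2l; rewrite ?subr_ge0 //; apply: IH; apply: If.
Qed.

Lemma avg_le p J f g w : prob_weights p -> (forall u, f u <= g u) ->
  avg p J f w <= avg p J g w.
Proof. by move=> pp fg; apply: (@avg_le_inv _ _ _ _ _ (fun=> True)). Qed.

Lemma avgD p J f g w : avg p J (fun u => f u + g u) w = avg p J f w + avg p J g w.
Proof. elim: J w => //= a J IH w; rewrite /avg1 !IH; ring. Qed.

Lemma avgZ p J c f w : avg p J (fun u => c * f u) w = c * avg p J f w.
Proof. elim: J w => //= a J IH w; rewrite /avg1 !IH; ring. Qed.

Lemma avg_cst p J c w : avg p J (fun=> c) w = c.
Proof. elim: J w => //= a J IH w; rewrite /avg1 !IH; ring. Qed.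

Lemma avgB p J f g w : avg p J (fun u => f u - g u) w = avg p J f w - avg p J g w.
Proof. elim: J w => //= a J IH w; rewrite /avg1 !IH; ring. Qed.

Lemma avg_sum (I : Type) (r : seq I) p J (F : I -> (T -> bool) -> R) w :
  avg p J (fun u => \sum_(i <- r) F i u) w = \sum_(i <- r) avg p J (F i) w.
Proof.
elim: r => [|i r IH].
  by under [X in avg p J X]funext do rewrite big_nil; rewrite avg_cst big_nil.
by under [X in avg p J X]funext do rewrite big_cons; rewrite avgD IH big_cons.
Qed.

Lemma avg_ge0 p J f w : prob_weights p -> (forall u, 0 <= f u) -> 0 <= avg p J f w.
Proof. by move=> pp f0; rewrite -(avg_cst p J 0 w); exact: avg_le. Qed.

(** Independence in the form used below: each coordinate is ignored by one of the factors, so that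
    no disjoint supports have to be exhibited. *)
Lemma avg_indepM p J f g w : (forall a, indep_of a f \/ indep_of a g) ->
  avg p J (fun u => f u * g u) w = avg p J f w * avg p J g w.
Proof.
move=> fg; elim: J w => //= a J IH w; rewrite /avg1 !IH.
by case: (fg a) => h; rewrite !(indep_avg p J h); ring.
Qed.

Lemma avg_mono_p p p' J f w : prob_weights p -> prob_weights p' ->
  (forall a, p a <= p' a) ->
  (forall u u' : T -> bool, (forall a, u a -> u' a) -> f u <= f u') ->
  avg p J f w <= avg p' J f w.
Proof.
move=> pp pp' lep fm.
have em q K : prob_weights q -> forall u u' : T -> bool, (forall a, u a -> u' a) -> avg q K f u <= avg q K f u'.
  move=> qq; elim: K => [|a K IH] u u' uu' /=; first exact: fm.
  have /andP[p0 p1] := qq a.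
  by apply: lerD; apply: ler_wpM2l; rewrite ?subr_ge0 //; apply: IH => b;
    rewrite /upd; case: eqP => // _; exact: uu'.
elim: J w => //= a J IH w; rewrite /avg1.
have /andP[p0 p1] := pp a; have /andP[p0' p1'] := pp' a.
have h1 := IH (upd w a true); have h0 := IH (upd w a false).
have h : avg p J f (upd w a false) <= avg p J f (upd w a true).
  by apply: em => // b; rewrite /upd; case: eqP.
have h' := lep a.
(* Intermediate quantity: the weight of [a] is raised first, those on [J] afterwards. *)
apply: (@le_trans _ _ (p' a * avg p J f (upd w a true) +
    (1 - p' a) * avg p J f (upd w a false))).
  have d1 : 0 <= p' a - p a by lra.
  have d2 : 0 <= avg p J f (upd w a true) - avg p J f (upd w a false) by lra.
  by rewrite -subr_ge0; have := mulr_ge0 d1 d2; lra.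
by apply: lerD; apply: ler_wpM2l; rewrite ?subr_ge0.
Qed.

Lemma avg_compl p J f w :
  avg p J f w = avg (fun a => 1 - p a) J (fun u => f (fun a => ~~ u a)) (fun a => ~~ w a).
Proof.
elim: J w => [|a J IH] w /=; first by congr f; apply/funext => a; rewrite negbK.
rewrite /avg1 !IH addrC; congr (_ * avg _ _ _ _ + _ * avg _ _ _ _).
- by apply/funext => b; rewrite /upd; case: eqP.
- ring.
- by apply/funext => b; rewrite /upd; case: eqP.
Qed.

(** [delta a f] does not look at [a], so being pivotal is independent of being open. This turns the
    terms of Russo's formula into probabilities of open pivotal coordinates. *)
Lemma avg_open p J a f w : a \in J ->
  avg p J (fun u => (u a)%:R * delta a f u) w = p a * avg p J (delta a f) w.
Proof.
move=> aJ; rewrite -avgZ -(avg_absorb _ _ aJ); congr avg; apply/funext => u.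
by rewrite /avg1 !upd_same !indep_delta /=; ring.
Qed.

Lemma avg_closed p J a f w : a \in J ->
  avg p J (fun u => (~~ u a)%:R * delta a f u) w = (1 - p a) * avg p J (delta a f) w.
Proof.
move=> aJ; rewrite -avgZ -(avg_absorb _ _ aJ); congr avg; apply/funext => u.
by rewrite /avg1 !upd_same !indep_delta /=; ring.
Qed.

(** Changing the state of [a] pairs configurations whose weights are in ratio [p a] to [1 - p a];
    cross-multiplied, the identity survives the weights 0 and 1. It gives the cost of closing a bond
    in [site_le_bonds]. *)
Lemma avg_swap p J a f w : a \in J ->
  p a * avg p J (fun u => (~~ u a)%:R * f u) w =
  (1 - p a) * avg p J (fun u => (u a)%:R * f (upd u a false)) w.
Proof.
move=> aJ; rewrite -!avgZ.
rewrite -(avg_absorb p (fun u => p a * _) aJ).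
rewrite -(avg_absorb p (fun u => (1 - p a) * _) aJ); congr (avg _ _ _ _).
by apply/funext => u; rewrite /avg1 !upd_same !upd_upd /=; ring.
Qed.

End Expectation.

Lemma avg_relabel (R : realFieldType) (T T' : eqType) (h : T -> T') (g : T' -> T)
    (p : T' -> R) J f w : cancel h g -> cancel g h ->
  avg p (map h J) f w = avg (p \o h) J (fun u => f (u \o g)) (w \o h).
Proof.
move=> hK gK.
elim: J w => [|a J IH] w /=.
  by congr f; apply/funext => x /=; rewrite gK.
rewrite /avg1 !IH /=.
have E v : upd w (h a) v \o h = upd (w \o h) a v.
  by apply/funext => x; rewrite /= /upd (inj_eq (can_inj hK)).
by rewrite !E.
Qed.

(** * Paths in the square lattice *)

Definition dir : Type := (bool * bool)%type.

(* [(v, s)] is the direction [+-e_1] (v = false) or [+-e_2] (v = true), with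
   sign [+] iff [s]. *)
Definition nb (x : site) (d : dir) : site :=
  match d with
  | (false, true) => (x.1 + 1, x.2)
  | (false, false) => (x.1 - 1, x.2)
  | (true, true) => (x.1, x.2 + 1)
  | (true, false) => (x.1, x.2 - 1)
  end.

(* [inl x] is the site x; [inr (x, v)] is the bond from x to [nb x (v, true)]. *)
Definition index : Type := (site + site * bool)%type.

Definition conf := index -> bool.

Definition ed (x : site) (d : dir) : index :=
  inr (if d.2 then x else nb x d, d.1).

Definition opp_dir (d : dir) : dir := (d.1, ~~ d.2).

Definition dirs : seq dir :=
  [:: (false, false); (false, true); (true, false); (true, true)].

Lemma mem_dirs d : d \in dirs.
Proof. by case: d => -[] []. Qed.

Lemma nbK x d : nb (nb x d) (opp_dir d) = x.
Proof. by case: x d => x1 x2 [[] []] /=; congr pair; lia. Qed.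

Lemma ed_opp x d : ed (nb x d) (opp_dir d) = ed x d.
Proof.
case: x d => x1 x2 [[] []] //=; congr (inr (pair _ _));
  rewrite /nb /=; congr pair; lia.
Qed.

Lemma nb_neq x d : nb x d <> x.
Proof. by case: x d => x1 x2 [[] []] /= [] ; lia. Qed.

Definition dist (x y : site) : nat := (`|(x.1 - y.1)%R| + `|(x.2 - y.2)%R|)%N.

Lemma norm1_dist x : norm1 x = dist 0 x.
Proof. by rewrite /norm1 /dist /= !sub0r !abszN. Qed.

Lemma dist_nbl x y d : (dist x (nb y d) <= (dist x y).+1)%N.
Proof. by case: x y d => x1 x2 [y1 y2] [[] []] /=; rewrite /dist /=; lia. Qed.

Lemma dist_triangle y x z : (dist x z <= dist x y + dist y z)%N.
Proof. by rewrite /dist; lia. Qed.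

Lemma distxx x : dist x x = 0%N.
Proof. by rewrite /dist; lia. Qed.

Section Reach.
Variable T : Type.
Implicit Types (r : T -> T -> Prop) (x y z : T).

Inductive reach r x : T -> Prop :=
| reach_refl : reach r x x
| reach_step y z : reach r x y -> r y z -> reach r x z.

Lemma reach_trans r x y z : reach r x y -> reach r y z -> reach r x z.
Proof. by move=> xy; elim=> // u v _ xu uv; exact: reach_step uv. Qed.

Lemma reach_mono r r' x y : (forall u v, r u v -> r' u v) ->
  reach r x y -> reach r' x y.
Proof.
move=> rr'; elim=> [|{}y z _ xy yz]; first exact: reach_refl.
by apply: reach_step xy _; exact: rr'.
Qed.

Lemma reach_sym r x y : (forall u v, r u v -> r v u) -> reach r x y -> reach r y x.
Proof.
move=> rs; elim=> [|{}y z _ yx yz]; first exact: reach_refl.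
by apply: reach_trans yx; apply: reach_step (reach_refl _ _) _; exact: rs.
Qed.

Lemma reach_inv r x y (I : T -> Prop) : I x ->
  (forall u v, reach r x u -> I u -> r u v -> I v) -> reach r x y -> I y.
Proof. by move=> Ix Ir xy; elim: xy => // {}y z xy Iy; exact: Ir. Qed.

(** The last exit is taken, not the first, because the rest of the path has to avoid [C] for good in
    order to be independent of the exploration of [C]. *)
Lemma reach_last_exit r (C : T -> Prop) x y : C x -> reach r x y -> ~ C y ->
  exists u v, [/\ C u, ~ C v, r u v &
    reach (fun a b => [/\ ~ C a, ~ C b & r a b]) v y].
Proof.
move=> Cx; elim=> // {}y z xy IH yz nCz.
have [Cy|nCy] := pselect (C y).
  by exists y, z; split => //; exact: reach_refl.
have [u [v [Cu nCv uv vy]]] := IH nCy.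
by exists u, v; split => //; apply: reach_step vy _.
Qed.

End Reach.

Section Links.
Implicit Types (w : conf) (A : site -> Prop).

Definition linked w (u v : site) := exists d, v = nb u d /\ w (ed u d).

Definition link_in A w (u v : site) := [/\ A u, A v & linked w u v].

Lemma linked_sym w u v : linked w u v -> linked w v u.
Proof.
by move=> [d [-> wd]]; exists (opp_dir d); rewrite nbK ed_opp.
Qed.

Lemma link_in_sym A w u v : link_in A w u v -> link_in A w v u.
Proof. by move=> [Au Av uv]; split => //; exact: linked_sym. Qed.

Lemma linked_irr w u v : linked w u v -> u <> v.
Proof. by move=> [d [-> _]]; apply/nesym; exact: nb_neq. Qed.

(** A step changes the distance by at most one, so the path cannot jump over the sphere of radius
    [m]; it is stopped on its first visit there. *)
Lemma reach_truncate A w x y z m : reach (link_in A w) x y ->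
  (dist z x <= m)%N -> (m <= dist z y)%N ->
  exists v, dist z v = m /\
    reach (link_in (fun u => A u /\ (dist z u <= m)%N) w) x v.
Proof.
move=> xy zx.
set G := (X in _ -> X); pose B u := A u /\ (dist z u <= m)%N.
suff [//|[h h'] zy] : G \/ (dist z y <= m)%N /\ reach (link_in B w) x y.
  by exists y; split => //; apply/eqP; rewrite eqn_leq h.
elim: xy => [|{}y t xy IH yt]; first by right; split => //; exact: reach_refl.
case: IH => [|[zy ry]]; first by left.
have [zym|zym] := eqVneq (dist z y) m; first by left; exists y.
right; case: yt => Ay At [d [td wd]].
have zt : (dist z t <= m)%N.
  by have := dist_nbl z y d; rewrite -td; move: zym zy; lia.
by split => //; apply: reach_step ry _; split => //; exists d.
Qed.

Definition arm z m w := exists v, dist z v = m /\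
  reach (link_in (fun u => (dist z u <= m)%N) w) z v.

(** If the path meets [y], then [a] is the side of its first arrival and [b] that of its last
    departure, so both outer pieces avoid [y]. *)
Lemma reach_split A w x y v : reach (link_in A w) x v -> y <> x -> v <> y ->
  let A' u := A u /\ u <> y in
  reach (link_in A' w) x v \/
  exists a b, [/\ reach (link_in A' w) x (nb y a), reach (link_in A' w) (nb y b) v,
     w (ed y a), w (ed y b) & A (nb y a) /\ A (nb y b)].
Proof.
move=> xv yx vy A'.
(* The induction must also cover the moments when the path stands at [y]; only the arrival is
   recorded then. *)
suff [] : (v <> y -> reach (link_in A' w) x v \/
  exists a b, [/\ reach (link_in A' w) x (nb y a), reach (link_in A' w) (nb y b) v,
     w (ed y a), w (ed y b) & A (nb y a) /\ A (nb y b)]) /\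
  (v = y -> exists a, [/\ reach (link_in A' w) x (nb y a), w (ed y a) & A (nb y a)]).
  by move=> /(_ vy).
elim: xv {vy} => [|{}v u xv [IH1 IH2] vu].
  by split; [left; exact: reach_refl|move=> /esym].
have [Av Au vu'] := vu; split=> [uy|uy].
  have [vy|vy] := pselect (v = y).
    have [a [ra wa Aa]] := IH2 vy; right; have [d [ud wd]] := vu'.
    exists a, d; rewrite -vy in ra wa Aa wd *; rewrite -ud; split => //.
    exact: reach_refl.
  have vu2 : link_in A' w v u by [].
  have [h|[a [b [h1 h2 h3 h4 h5]]]] := IH1 vy.
    by left; exact: reach_step vu2.
  by right; exists a, b; split => //; exact: reach_step vu2.
have vy : v <> y by rewrite -uy; exact: linked_irr vu'.
have [d [vd wd]] := linked_sym vu'; rewrite uy in vd wd.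
have [h|[a [b [h1 h2 h3 h4 h5]]]] := IH1 vy.
  by exists d; split; rewrite -?vd.
by exists a; split => //; case: h5.
Qed.

End Links.

Lemma reach_link_in_eq A (w w' : conf) x y :
  (forall u d, A u -> A (nb u d) -> w (ed u d) -> w' (ed u d)) ->
  reach (link_in A w) x y -> reach (link_in A w') x y.
Proof.
move=> ww'; apply: reach_mono => u v [Au Av [d [vd wd]]].
by split => //; exists d; split => //; apply: ww'; rewrite // -vd.
Qed.

Lemma reach_link_in_sub (A A' : site -> Prop) w x y : (forall u, A u -> A' u) ->
  reach (link_in A w) x y -> reach (link_in A' w) x y.
Proof. by move=> AA'; apply: reach_mono => u v [/AA' ? /AA' ?]. Qed.

Section Box.
Implicit Types (x y z : site) (N m : nat).

Definition box z N : seq site :=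
  [seq (z.1 + (i%:Z - N%:Z), z.2 + (j%:Z - N%:Z)) |
    i <- iota 0 (N.*2.+1), j <- iota 0 (N.*2.+1)].

Lemma mem_box z x N : (dist z x <= N)%N -> x \in box z N.
Proof.
case: z x => z1 z2 [x1 x2]; rewrite /dist /= => h.
apply/allpairsP; exists (`|(x1 - z1 + N%:Z)%R|%N, `|(x2 - z2 + N%:Z)%R|%N).
by split; [rewrite mem_iota /=; lia|rewrite mem_iota /=; lia|rewrite /=; congr pair; lia].
Qed.

Lemma box_uniq z N : uniq (box z N).
Proof.
apply: allpairs_uniq; rewrite ?iota_uniq // => -[a b] [a' b'] _ _ /= [].
by move=> h1 h2; congr pair; lia.
Qed.

(** A bond with both ends in the box is listed from each of them; duplicates are removed because
    Russo's formula takes each coordinate once. *)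
Definition bonds z N : seq index :=
  undup [seq ed x d | x <- box z N, d <- dirs].

Lemma mem_bonds z x d N : (dist z x <= N)%N -> ed x d \in bonds z N.
Proof.
by move=> h; rewrite mem_undup; apply/allpairsP; exists (x, d);
  rewrite mem_box ?mem_dirs.
Qed.

Lemma bonds_inr z N a : a \in bonds z N -> exists k, a = inr k.
Proof. by rewrite mem_undup => /allpairsP[[x d] [_ _ ->]]; eexists. Qed.

End Box.

Arguments box : simpl never.

Lemma sum_uniq_sub (R : numDomainType) (I : eqType) (h : I -> R) (s t : seq I) :
  (forall i, 0 <= h i) -> uniq s -> {subset s <= t} ->
  \sum_(i <- s) h i <= \sum_(i <- t) h i.
Proof.
move=> h0; elim: t s => [|i t IH] s us st.
  by case: s us st => // i s _ /(_ i); rewrite mem_head => /(_ isT).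
rewrite big_cons; have [si|si] := boolP (i \in s).
  rewrite (perm_big _ (perm_to_rem si)) big_cons lerD2l; apply: IH; first exact: rem_uniq.
  move=> j; rewrite mem_rem_uniq // inE => /andP[/= ji /st].
  by rewrite inE (negPf ji).
rewrite -[X in X <= _]add0r; apply: lerD => //; apply: IH => // j sj.
by have := st _ sj; rewrite inE => /orP[/eqP ji|//]; rewrite -ji sj in si.
Qed.

(* Each bond is read off from exactly its two end-sites. *)
Lemma sum_dirs_le (R : numDomainType) (h : site -> dir -> R) (G : index -> R) z N :
  (forall x d, 0 <= h x d) ->
  (forall x v, h x (v, true) + h (nb x (v, true)) (v, false) <= G (ed x (v, true))) ->
  \sum_(x <- box z N) \sum_(d <- dirs) h x d <= \sum_(e <- bonds z N) G e.
Proof.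
move=> h0 hG.
pose H (q : site * dir) := h q.1 q.2.
pose k1 (e : index) : site * dir := if e is inr (y, v) then (y, (v, true)) else (0, (true, true)).
pose k2 (e : index) : site * dir :=
  if e is inr (y, v) then (nb y (v, true), (v, false)) else (0, (true, true)).
have -> : \sum_(x <- box z N) \sum_(d <- dirs) h x d =
    \sum_(q <- [seq (x, d) | x <- box z N, d <- dirs]) H q.
  by rewrite [RHS]big_allpairs_dep.
apply: (@le_trans _ _ (\sum_(e <- bonds z N) (H (k1 e) + H (k2 e)))).
  rewrite big_split -(big_map k1 xpredT H) -(big_map k2 xpredT H) -big_cat.
  apply: sum_uniq_sub.
  - by move=> [x d]; exact: h0.
  - by apply: (@allpairs_uniq _ _ _ pair) => //; [exact: box_uniq|move=> [? ?] [? ?]].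
  move=> q /allpairsP[[x [v s]] [/= xz _ ->]].
  have xb : ed x (v, s) \in bonds z N.
    by rewrite mem_undup; apply/allpairsP; exists (x, (v, s)); rewrite mem_dirs.
  rewrite mem_cat; apply/orP; case: s xb => xb; [left|right]; apply/mapP.
    by exists (ed x (v, true)).
  exists (ed x (v, false)) => //.
  by rewrite /k2 /ed /=; congr pair; have /= -> := nbK x (v, false).
rewrite big_seq [X in _ <= X]big_seq; apply: ler_sum => e /bonds_inr[[y v] ->].
exact: hG.
Qed.

(** * Events and their probabilities *)

Definition ind (R : realFieldType) (A : conf -> Prop) (w : conf) : R :=
  (`[< A w >])%:R.

Lemma ind_ge0 (R : realFieldType) A w : 0 <= ind R A w.
Proof. exact: ler0n. Qed.

Lemma ind1 (R : realFieldType) A w : A w -> ind R A w = 1.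
Proof. by move=> Aw; rewrite /ind asboolT. Qed.

Lemma ind0 (R : realFieldType) A w : ~ A w -> ind R A w = 0.
Proof. by move=> Aw; rewrite /ind asboolF. Qed.

Lemma ind_le (R : realFieldType) (A B : conf -> Prop) w w' : (A w -> B w') -> ind R A w <= ind R B w'.
Proof.
move=> AB; have [Aw|Aw] := pselect (A w); last by rewrite ind0 ?ind_ge0.
by rewrite !ind1 //; exact: AB.
Qed.

Lemma ind_and (R : realFieldType) (A B : conf -> Prop) w :
  ind R (fun u => A u /\ B u) w = ind R A w * ind R B w.
Proof. by rewrite /ind asbool_and -mulnb natrM. Qed.

Lemma sum_ge_term (R : numDomainType) (I : eqType) (F : I -> R) (s : seq I) i :
  (forall j, 0 <= F j) -> i \in s -> F i <= \sum_(j <- s) F j.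
Proof.
move=> F0 is_; rewrite (perm_big _ (perm_to_rem is_)) big_cons lerDl.
exact: sumr_ge0.
Qed.

Lemma indep_ind (R : realFieldType) (A : conf -> Prop) a :
  (forall w v, A w -> A (upd w a v)) -> indep_of a (ind R A).
Proof.
move=> hA w v; rewrite /ind; congr (nat_of_bool _)%:R; apply: asbool_equiv_eq.
split=> [|/hA//]; move=> /hA; move/(_ (w a)); by rewrite upd_upd upd_id.
Qed.

Lemma supported_ind (R : realFieldType) (A : conf -> Prop) (J : seq index) :
  (forall w w' : conf, {in J, w =1 w'} -> A w -> A w') -> supported J (ind R A).
Proof.
move=> hA w w' ww'; rewrite /ind; congr (nat_of_bool _)%:R; apply: asbool_equiv_eq.
by split; apply: hA => // a /ww'.
Qed.

Lemma reach_upd A w a v x y :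
  (forall u d, ed u d = a -> A u -> A (nb u d) -> False) ->
  reach (link_in A w) x y -> reach (link_in A (upd w a v)) x y.
Proof.
move=> ha; apply: reach_link_in_eq => u d Au And wd; rewrite upd_other //.
by apply/eqP => ea; exact: (ha u d).
Qed.

Lemma reach_agree A (w w' : conf) z N x y : (forall u, A u -> (dist z u <= N)%N) ->
  {in bonds z N, w =1 w'} ->
  reach (link_in A w) x y -> reach (link_in A w') x y.
Proof.
move=> AN ww'; apply: reach_link_in_eq => u d /AN Au _.
by rewrite ww' // mem_bonds.
Qed.

Lemma reach_incr A (w w' : conf) x y : (forall a, w a -> w' a) ->
  reach (link_in A w) x y -> reach (link_in A w') x y.
Proof. by move=> ww'; apply: reach_link_in_eq => u d _ _; exact: ww'. Qed.

Lemma arm_incr z m (w w' : conf) : (forall a, w a -> w' a) -> arm z m w -> arm z m w'.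
Proof. by move=> ww' [v [vm zv]]; exists v; split => //; exact: reach_incr zv. Qed.

Lemma arm_supported (R : realFieldType) y m z N : (dist z y + m <= N)%N ->
  supported (bonds z N) (ind R (arm y m)).
Proof.
move=> zyN; apply: supported_ind => w w' ww' [v [vm zv]]; exists v; split => //.
by apply: reach_agree ww' zv => u um; have := dist_triangle y z u; lia.
Qed.

Definition shift (z : site) (a : index) : index :=
  match a with
  | inl x => inl (x.1 + z.1, x.2 + z.2)
  | inr (x, v) => inr ((x.1 + z.1, x.2 + z.2), v)
  end.

Lemma shiftK z : cancel (shift z) (shift (- z.1, - z.2)).
Proof. by case=> [[a b]|[[a b] v]]; rewrite /shift /= !addrK. Qed.

Lemma shiftNK z : cancel (shift (- z.1, - z.2)) (shift z).
Proof. by case=> [[a b]|[[a b] v]]; rewrite /shift /= !subrK. Qed.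

Lemma shift_ed z x d : shift z (ed x d) = ed (x.1 + z.1, x.2 + z.2) d.
Proof.
case: x d => x1 x2 [[] []]; rewrite /ed /shift /=; congr (inr (pair (pair _ _) _)); lia.
Qed.

Lemma shift_nb z x d : nb (x.1 + z.1, x.2 + z.2) d = ((nb x d).1 + z.1, (nb x d).2 + z.2).
Proof. by case: x d => x1 x2 [[] []]; rewrite /nb /=; congr pair; lia. Qed.

Lemma reach_map T T' (h : T -> T') r r' u v : (forall a b, r a b -> r' (h a) (h b)) ->
  reach r u v -> reach r' (h u) (h v).
Proof.
move=> hr; elim=> [|{}v t _ uv vt]; first exact: reach_refl.
by apply: reach_step uv _; exact: hr.
Qed.

Lemma arm_shift z x m w : arm x m (w \o shift z) -> arm (x.1 + z.1, x.2 + z.2) m w.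
Proof.
move=> [v [vm xv]]; exists (v.1 + z.1, v.2 + z.2); split.
  by rewrite -vm /dist /=; lia.
apply: (reach_map (h := fun u : site => (u.1 + z.1, u.2 + z.2))) xv => a b [am bm [d [bd wd]]].
split; [move: am|move: bm|]; rewrite /dist /=; [lia|lia|].
by exists d; rewrite bd shift_nb; split => //; rewrite -shift_ed; exact: wd.
Qed.

Definition zeroconf : conf := fun=> false.

(* Bond percolation of parameter t; J is a finite set of coordinates on which
   f depends. *)
Definition pr (R : realFieldType) (t : R) (J : seq index) (f : conf -> R) : R :=
  avg (fun=> t) J f zeroconf.

Definition parm (R : realFieldType) (t : R) (m : nat) : R :=
  pr t (bonds 0 m) (ind R (arm 0 m)).

(** Translation invariance, by relabelling the coordinates with [shift y]; the box over which one
    averages is immaterial once it contains the support. *)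
Lemma pr_arm (R : realFieldType) (t : R) y m z N : (dist z y + m <= N)%N ->
  pr t (bonds z N) (ind R (arm y m)) = parm t m.
Proof.
move=> zyN; have h := arm_supported R zyN.
have h' : supported (map (shift y) (bonds 0 m)) (ind R (arm y m)).
  have := arm_supported R (_ : (dist y y + m <= m)%N).
  rewrite distxx => /(_ (leqnn _)); apply: supportedS => a.
  rewrite mem_undup => /allpairsP[[x d] [/= xb _ ->]].
  apply/mapP; exists (ed (x.1 - y.1, x.2 - y.2) d); last first.
    by rewrite shift_ed /= !subrK -surjective_pairing.
  rewrite mem_undup; apply/allpairsP; exists ((x.1 - y.1, x.2 - y.2), d).
  split=> //=; last exact: mem_dirs.
  case/allpairsP: xb => -[i j] [/= ii jj ->] /=.
  apply/allpairsP; exists (i, j); split => //=.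
  by congr pair; rewrite add0r addrAC subrr add0r.
rewrite /pr (avg_supported _ _ zeroconf h h').
rewrite (avg_relabel _ _ _ _ (shiftK y) (shiftNK y)).
rewrite /parm /pr; congr (avg _ _ _ _); apply/funext => w.
rewrite /ind; congr (nat_of_bool _)%:R; apply: asbool_equiv_eq; split=> ha.
  by have := arm_shift ha; rewrite /= !subrr.
have := @arm_shift y 0 m (w \o shift (- y.1, - y.2)); rewrite /= !add0r -surjective_pairing; apply.
rewrite (_ : (w \o _) \o _ = w) //; apply/funext => a /=; congr w; exact: shiftK.
Qed.
(** * Planar duality *)

Lemma abel_sum (R : comPzRingType) (n : nat) (g h : nat -> R) :
  \sum_(i < n.+1) g i * (h i.+1 - h i) =
  g n * h n.+1 - g 0%N * h 0%N - \sum_(i < n) (g i.+1 - g i) * h i.+1.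
Proof.
elim: n => [|n IH]; first by rewrite big_ord_recr !big_ord0 /=; ring.
by rewrite big_ord_recr IH [X in _ = _ - X]big_ord_recr /=; ring.
Qed.

(* A discrete form of [\int dx /\ dd]: the difference of the sums over the two
   families of products only depends on the boundary values, which make it
   equal to 1. *)
Lemma hex_boundary (n : nat) (x d : nat -> nat -> int) :
  (forall a, (a <= n)%N -> x 0%N a = 1) -> (forall a, (a <= n)%N -> x n.+1 a = 0) ->
  (forall c, (c <= n)%N -> d 0%N c = 1) -> (forall c, (c <= n)%N -> d n.+1 c = 0) ->
  (forall a c, (a <= n)%N -> (c <= n)%N ->
     (x c.+1 a - x c a) * (d a.+1 c - d a c) = 0) ->
  (forall a c, (a < n)%N -> (c < n)%N ->
     (d a.+1 c.+1 - d a.+1 c) * (x c.+1 a.+1 - x c.+1 a) = 0) ->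
  False.
Proof.
move=> x0 xn d0 dn H1 H2.
have : \sum_(c < n.+1) \sum_(a < n.+1) (x c.+1 a - x c a) * (d a.+1 c - d a c) = 0.
  by apply: big1 => c _; apply: big1 => a _; apply: H1; rewrite -ltnS.
under eq_bigr => c _.
  rewrite (abel_sum n (fun a => x c.+1 a - x c a) (fun a => d a c)).
  rewrite d0 ?leq_ord // dn ?leq_ord // mulr0 mulr1 sub0r.
  over.
rewrite big_split /= sumrN sumrN -(big_mkord xpredT (fun c => x c.+1 0%N - x c 0%N)).
rewrite telescope_sumr // x0 // xn // exchange_big /= big1 ?subr0 ?sub0r ?opprK //.
move=> a _; have an := ltn_ord a.
have := abel_sum n (fun c => d a.+1 c) (fun c => x c a.+1 - x c a).
rewrite !x0 ?(ltnW an) // !xn ?(ltnW an) // !subrr !mulr0 !sub0r.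
rewrite [X in - X]big1 ?oppr0 => [h|c _]; last by rewrite H2.
by rewrite -[RHS]h; apply: eq_bigr => c _; ring.
Qed.

Section Crossing.
Variable n : nat.

Definition rect (u : site) : Prop := 0 <= u.1 <= n.+1%:Z /\ 0 <= u.2 <= n%:Z.

Definition crossing (w : conf) := exists j k : nat,
  (j <= n)%N /\ reach (link_in rect w) (0, j%:Z) (n.+1%:Z, k%:Z).

(* The dual of a horizontal (resp. vertical) bond, in coordinates in which the
   dual rectangle is again [rect], rotated by a quarter turn. *)
Definition dual_bond (a : index) : index :=
  match a with
  | inl x => inl x
  | inr ((i, j), false) => inr ((j, i), false)
  | inr ((i, j), true) => inr ((j + 1, i - 1), true)
  end.

Lemma dual_bondK : involutive dual_bond.
Proof.
by case=> [//|[[i j] []]] /=; rewrite ?addrK ?subrK.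
Qed.

Definition dual (w : conf) : conf := fun a => ~~ w (dual_bond a).

(** The function [x w] of the proof indicates the sites joined to the left side within [rect], and
    is constant along open bonds. Since a bond is open in [w] or its dual is open in [dual w], every
    product in [hex_boundary] has a zero factor; the absence of both crossings supplies the boundary
    values which that lemma excludes. *)
Lemma crossing_or_dual w : crossing w \/ crossing (dual w).
Proof.
pose C w (i j : nat) := exists j0 : nat, (j0 <= n)%N /\
  reach (link_in rect w) (0, j0%:Z) (i%:Z, j%:Z).
pose x w i j : int := (`[< C w i j >])%:R.
have x1 w' j : (j <= n)%N -> x w' 0%N j = 1.
  by move=> jn; rewrite /x asboolT //; exists j; split => //; exact: reach_refl.
have [|nc] := pselect (crossing w); first by left.
right; apply: contrapT => nc'.
have x0 w' j : ~ crossing w' -> x w' n.+1 j = 0.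
  by move=> ncw; rewrite /x asboolF // => -[j0 [jn jj]]; apply: ncw; exists j0, j.
have xE (w' : conf) i j d i' j' : rect (i%:Z, j%:Z) -> rect (i'%:Z, j'%:Z) ->
    (i'%:Z, j'%:Z) = nb (i%:Z, j%:Z) d -> w' (ed (i%:Z, j%:Z) d) -> x w' i j = x w' i' j'.
  move=> rij rij' ij' wd; rewrite /x; congr (nat_of_bool _)%:R; apply: asbool_equiv_eq.
  have l : link_in rect w' (i%:Z, j%:Z) (i'%:Z, j'%:Z) by split => //; exists d.
  split=> -[j0 [jn h]]; exists j0; split => //; first exact: reach_step l.
  by apply: reach_step h _; exact: link_in_sym.
apply: (@hex_boundary n (x w) (x (dual w))) => [a|a _|c|c _|a c an cn|a c an cn].
- exact: x1.
- exact: x0.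
- exact: x1.
- exact: x0.
- have [wc|wc] := boolP (w (inr ((c%:Z, a%:Z), false))).
    rewrite (xE w c a (false, true) c.+1 a) ?subrr ?mul0r //; try (rewrite /rect /=; lia).
    by rewrite /nb /=; congr pair; lia.
  rewrite (xE (dual w) a c (false, true) a.+1 c) ?subrr ?mulr0 //; try (rewrite /rect /=; lia).
  by rewrite /nb /=; congr pair; lia.
- have [wc|wc] := boolP (w (inr ((c.+1%:Z, a%:Z), true))).
    rewrite (xE w c.+1 a (true, true) c.+1 a.+1) ?subrr ?mulr0 //; try (rewrite /rect /=; lia).
    by rewrite /nb /=; congr pair; lia.
  rewrite (xE (dual w) a.+1 c (true, true) a.+1 c.+1) ?subrr ?mul0r //; try (rewrite /rect /=; lia).
    by rewrite /nb /=; congr pair; lia.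
  have e1 : c%:Z + 1 = c.+1%:Z by lia.
  have e2 : a.+1%:Z - 1 = a%:Z by lia.
  by rewrite /dual /= e1 e2.
Qed.

Lemma rect_dist u : rect u -> (dist 0%R u <= n + n.+1)%N.
Proof. by case: u => a b; rewrite /rect /dist /=; lia. Qed.

Variable R : realFieldType.

(** The sites of [rect] lie within distance 2n + 1 of the origin; the larger radius leaves room for
    the duals of its bonds. *)
Let J := bonds 0 (n + n + 3).

Lemma crossing_supported : supported J (ind R crossing).
Proof.
apply: supported_ind => w w' ww' [j [k [jn jk]]]; exists j, k; split => //.
by apply: reach_agree ww' jk => u /rect_dist; lia.
Qed.

Lemma crossing_supported_dual : supported (map dual_bond J) (ind R crossing).
Proof.
apply: supported_ind => w w' ww' [j [k [jn jk]]]; exists j, k; split => //.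
apply: reach_link_in_eq jk => u d ru rn; rewrite ww' //.
apply/mapP; exists (dual_bond (ed u d)); last by rewrite dual_bondK.
have := rect_dist ru; case: u d {ru rn} => a b [[] []] ab; rewrite /ed /=.
- by apply: (@mem_bonds _ (b + 1, a - 1) (true, true)); move: ab; rewrite /dist /=; lia.
- by apply: (@mem_bonds _ (b - 1 + 1, a - 1) (true, true)); move: ab; rewrite /dist /=; lia.
- by apply: (@mem_bonds _ (b, a) (false, true)); move: ab; rewrite /dist /=; lia.
- by apply: (@mem_bonds _ (b, a - 1) (false, true)); move: ab; rewrite /dist /=; lia.
Qed.

(** Dual bonds are open with probability 1 - t <= t, so by monotonicity the dual crossing is at most
    as likely as the crossing, and one of the two always occurs. *)
Lemma pr_crossing (t : R) : 1 / 2 <= t <= 1 -> 1 / 2 <= pr t J (ind R crossing).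
Proof.
move=> /andP[t2 t1].
have pw : prob_weights (fun _ : index => t) by move=> _; lra.
have pw' : prob_weights (fun _ : index => 1 - t) by move=> _; lra.
have h : 1 <= pr t J (ind R crossing) + pr t J (fun u => ind R crossing (dual u)).
  rewrite /pr -avgD -(avg_cst (fun=> t) J 1 zeroconf); apply: avg_le => // u.
  case: (crossing_or_dual u) => c.
    by rewrite (ind1 _ c) lerDl ind_ge0.
  by rewrite [X in _ <= _ + X](ind1 _ c) lerDr ind_ge0.
suff : pr t J (fun u => ind R crossing (dual u)) <= pr t J (ind R crossing) by lra.
have -> : pr t J (fun u => ind R crossing (dual u)) =
    avg (fun=> 1 - t) (map dual_bond J) (ind R crossing) (fun=> true).
  rewrite (avg_compl (fun=> 1 - t)) (avg_relabel _ _ _ _ dual_bondK dual_bondK).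
  rewrite /pr; apply: avg_ext => a _ /=; lra.
have -> : avg (fun=> 1 - t) (map dual_bond J) (ind R crossing) (fun=> true) =
    avg (fun=> 1 - t) J (ind R crossing) zeroconf.
  exact: avg_supported crossing_supported_dual crossing_supported.
apply: avg_mono_p => //; first by move=> _; lra.
move=> u u' uu'; apply: ind_le => -[j [k [jn jk]]]; exists j, k; split => //.
exact: reach_incr jk.
Qed.

(** A crossing starts at one of the n + 1 sites of the left side and travels a distance of at least
    n + 1: this is a union bound over translated arms. *)
Lemma parm_ge (t : R) : 1 / 2 <= t <= 1 -> 1 / 2 <= n.+1%:R * parm t n.+1.
Proof.
move=> /[dup] t01 /pr_crossing /le_trans; apply.
have pw : prob_weights (fun _ : index => t) by move=> _; lra.
have -> : n.+1%:R * parm t n.+1 =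
    pr t J (fun u => \sum_(j < n.+1) ind R (arm (0, j%:Z) n.+1) u).
  rewrite /pr avg_sum (eq_bigr (fun=> parm t n.+1)).
    by rewrite sumr_const card_ord mulr_natl.
  move=> j _; have jn := ltn_ord j.
  by apply: (pr_arm t); rewrite /dist /=; lia.
apply: avg_le => // u.
have [[j [k [jn jk]]]|c] := pselect (crossing u); last first.
  by rewrite ind0 //; apply: sumr_ge0 => i _; exact: ind_ge0.
have jn' : (j < n.+1)%N by [].
rewrite (bigD1 (Ordinal jn')) //=; apply: (@le_trans _ _ (ind R (arm (0, j%:Z) n.+1) u)).
  rewrite [X in _ <= X]ind1; first by rewrite /ind; case: (`[< _ >]) => //=.
  have h1 : (dist (0%R, j%:Z) (0%R, j%:Z) <= n.+1)%N by rewrite distxx.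
  have h2 : (n.+1 <= dist (0%R, j%:Z) (n.+1%:Z, k%:Z))%N by rewrite /dist /=; lia.
  have [v [vm jv]] := reach_truncate jk h1 h2.
  by exists v; split => //; apply: reach_link_in_sub jv => ? [].
by rewrite lerDl; apply: sumr_ge0 => i _; exact: ind_ge0.
Qed.

End Crossing.

(** * Exponential decay and the mean-field lower bound *)

Section Coordinates.
Implicit Types (S C : {fset site}) (a : index).

Definition within S a : bool :=
  if a is inr (y, v) then (y \in S) && (nb y (v, true) \in S) else false.

Definition touches C a : bool :=
  if a is inr (y, v) then (y \in C) || (nb y (v, true) \in C) else false.

Lemma within_ed S x d : within S (ed x d) = (x \in S) && (nb x d \in S).
Proof. case: d => v [//|]; have e : nb (nb x (v, false)) (v, true) = x := nbK x (v, false).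
by rewrite -[LHS]/((_ \in _) && (nb (nb x (v, false)) (v, true) \in _)) e andbC. Qed.

Lemma touches_ed C x d : touches C (ed x d) = (x \in C) || (nb x d \in C).
Proof. case: d => v [//|]; have e : nb (nb x (v, false)) (v, true) = x := nbK x (v, false).
by rewrite -[LHS]/((_ \in _) || (nb (nb x (v, false)) (v, true) \in _)) e orbC. Qed.

End Coordinates.

(** * Exits from a finite set and decay of the arm probability *)

Section Exit.
Variable R : realFieldType.
Implicit Types (S C : {fset site}) (w : conf).

Definition inner S x w := reach (link_in (fun u => u \in S) w) 0 x.

(** Exits are counted whether open or closed. An exit bond is independent of the connections inside
    [S], so the quantity phi(S) of Duminil-Copin and Tassion is t times the expectation of this
    sum. *)
Definition exitsum S w : R :=
  \sum_(x <- S) \sum_(d <- dirs) (nb x d \notin S)%:R * ind R (inner S x) w.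

Lemma exitsum_ge0 S w : 0 <= exitsum S w.
Proof.
by apply: sumr_ge0 => x _; apply: sumr_ge0 => d _; rewrite mulr_ge0 ?ind_ge0 ?ler0n.
Qed.

Lemma inner_supported S x N : (forall u, u \in S -> (dist 0%R u <= N)%N) ->
  supported (bonds 0 N) (ind R (inner S x)).
Proof.
by move=> SN; apply: supported_ind => w w' ww'; exact: reach_agree SN ww'.
Qed.

Lemma exitsum_supported S N : (forall u, u \in S -> (dist 0%R u <= N)%N) ->
  supported (bonds 0 N) (exitsum S).
Proof.
move=> SN w w' ww'; apply: eq_bigr => x _; apply: eq_bigr => d _.
by rewrite (inner_supported x SN ww').
Qed.

Lemma inner_indep S x a : ~~ within S a -> indep_of a (ind R (inner S x)).
Proof.
move=> aS; apply: indep_ind => w v; apply: reach_upd => u d ea uS vS.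
by move: aS; rewrite -ea within_ed uS vS.
Qed.

Lemma exitsum_indep S a : ~~ within S a -> indep_of a (exitsum S).
Proof.
move=> aS w v; apply: eq_bigr => x _; apply: eq_bigr => d _.
by rewrite (inner_indep x aS).
Qed.

Lemma sum_ind_eq (cl : conf -> {fset site}) S (F : {fset site} -> R) w :
  (cl w `<=` S)%fset ->
  \sum_(C <- fpowerset S) F C * ind R (fun u => cl u = C) w = F (cl w).
Proof.
move=> clS; rewrite (bigD1_seq (cl w)) ?fpowersetE ?fset_uniq //= ind1 // mulr1.
rewrite big1 ?addr0 // => C neq; rewrite ind0 ?mulr0 // => e.
by rewrite e eqxx in neq.
Qed.

Definition cluster S w : {fset site} := [fset x in S | `[< inner S x w >]]%fset.

Lemma in_cluster S w x : x \in S -> (x \in cluster S w) = `[< inner S x w >].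
Proof. by move=> xS; rewrite !inE /= xS. Qed.

Lemma cluster_sub S w : (cluster S w `<=` S)%fset.
Proof. by apply/fsubsetP => x; rewrite !inE /= => /andP[]. Qed.

(** Exploring the cluster from the origin reveals only bonds inside [S] with an end in the
    cluster. *)
Lemma cluster_indep S C a : 0 \in S -> ~~ (within S a && touches C a) ->
  indep_of a (ind R (fun w => cluster S w = C)).
Proof.
move=> S0 aSC; apply: indep_ind => w v wC.
have na u d : u \in C -> u \in S -> nb u d \in S -> ed u d != a.
  move=> uC uS dS; apply: contraNneq aSC => <-.
  by rewrite within_ed touches_ed uS dS uC.
apply/fsetP => z; rewrite -wC !inE /=; congr (_ && _).
apply: asbool_equiv_eq; split=> h.
  have [] // : inner S z w /\ z \in S.
  apply: (reach_inv (I := fun z => inner S z w /\ z \in S)) h; first by split => //; exact: reach_refl.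
  move=> u u' _ [uw uS] [_ uS' [d [du wd]]]; split => //.
  apply: (reach_step uw); split => //; exists d; split => //.
  have uC : u \in C by rewrite -wC in_cluster //; apply/asboolP.
  by rewrite upd_other ?na -?du in wd.
apply: (reach_inv (I := fun u => inner S u (upd w a v))) h; first exact: reach_refl.
move=> u u' uw uI [uS uS' [d [du wd]]].
apply: reach_step uI _; split => //; exists d; split => //.
have uC : u \in C by rewrite -wC in_cluster //; apply/asboolP.
by rewrite upd_other ?na -?du.
Qed.

Definition off C y m w := exists v, dist y v = m /\
  reach (link_in (fun u => u \notin C /\ (dist y u <= m)%N) w) y v.

Lemma off_indep C y m a : touches C a -> indep_of a (ind R (off C y m)).
Proof.
move=> aC; apply: indep_ind => w v [z [zm yz]]; exists z; split => //.
apply: reach_upd yz => u d ea [uC _] [dC _].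
by move: aC; rewrite -ea touches_ed (negPf uC) (negPf dC).
Qed.

Lemma pr_open (t : R) J a : a \in J -> pr t J (ind R (fun u => u a)) = t.
Proof.
move=> aJ; rewrite /pr -(avg_absorb _ _ aJ) -[RHS](avg_cst (fun=> t) J t zeroconf).
congr avg; apply/funext => u; rewrite /avg1 ind1 ?upd_same // ind0 ?upd_same //; ring.
Qed.

(** The arm is cut at its last exit from the cluster of 0 in [S]. The far end of the open exit bond
    lies off [S], since otherwise it would belong to the cluster; it is within distance [L] of 0, so
    a distance of at least [m] is left to travel off the cluster. *)
Lemma arm_le_exits S L m w : 0 \in S -> (forall x, x \in S -> (dist 0%R x < L)%N) ->
  ind R (arm 0 (m + L)) w <=
  \sum_(x <- S) \sum_(d <- dirs) (nb x d \notin S)%:R *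
    \sum_(C <- fpowerset S) (x \in C)%:R *
      (ind R (fun u => cluster S u = C /\ u (ed x d)) w * ind R (off C (nb x d) m) w).
Proof.
move=> S0 SL.
have F0 (x : site) (d : dir) C :
  0 <= (x \in C)%:R * (ind R (fun u => cluster S u = C /\ u (ed x d)) w * ind R (off C (nb x d) m) w).
  by rewrite !mulr_ge0 ?ind_ge0 ?ler0n.
have [[v [vm zv]]|narm] := pselect (arm 0 (m + L) w); last first.
  rewrite ind0 //; apply: sumr_ge0 => x _; apply: sumr_ge0 => d _.
  by rewrite mulr_ge0 ?ler0n //; apply: sumr_ge0 => C _.
have c0 : 0 \in cluster S w by rewrite in_cluster //; apply/asboolP; exact: reach_refl.
have vS : v \notin S by apply/negP => /SL; rewrite vm; lia.
have vC : ~ v \in cluster S w by move=> h; move: vS; rewrite (fsubsetP (cluster_sub S w) _ h).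
have [x [y [xC yC [x1 y1 [d [yd wd]]] yv]]] :=
  reach_last_exit (C := fun x => x \in cluster S w) c0 zv vC.
have xS := fsubsetP (cluster_sub S w) _ xC.
have yS : y \notin S.
  apply/negP => yS; apply: yC; rewrite in_cluster //; apply/asboolP.
  have := xC; rewrite in_cluster // => /asboolP xI.
  by apply: reach_step xI _; split => //; exists d.
have h1 : (dist y y <= m)%N by rewrite distxx.
have h2 : (m <= dist y v)%N.
  have := dist_triangle y 0 v; have := SL _ xS; have := dist_nbl 0 x d.
  by rewrite -yd vm; lia.
have yv' : reach (link_in (fun u => u \notin cluster S w) w) y v.
  by apply: reach_mono yv => a b [/negP ? /negP ? []].
have [z [zm yz]] := reach_truncate yv' h1 h2.
apply: le_trans (sum_ge_term _ xS); last first.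
  move=> x'; apply: sumr_ge0 => d' _.
  by rewrite mulr_ge0 ?ler0n //; apply: sumr_ge0 => C _.
apply: le_trans (sum_ge_term _ (mem_dirs d)); last first.
  by move=> d'; rewrite mulr_ge0 ?ler0n //; apply: sumr_ge0 => C _.
rewrite -yd yS mul1r.
have CS : cluster S w \in fpowerset S by rewrite fpowersetE cluster_sub.
apply: le_trans (sum_ge_term _ CS); last by move=> C; rewrite yd.
rewrite xC mul1r [X in X * _]ind1 // mul1r [X in _ <= X]ind1.
  by rewrite /ind; case: (`[< _ >]) => //=.
by exists z.
Qed.

(** Once the cluster is prescribed, three disjoint sets of coordinates are involved: bonds inside
    [S] touching the cluster, the exit bond (whence the factor [t]), and bonds that do not touch the
    cluster. The arm off the cluster is bounded by an unrestricted one. *)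
Lemma parm_decay (t : R) S L m : 0 <= t <= 1 -> 0 \in S ->
  (forall x, x \in S -> (dist 0%R x < L)%N) ->
  parm t (m + L) <= t * pr t (bonds 0 L) (exitsum S) * parm t m.
Proof.
move=> t01 S0 SL; pose J := bonds 0 (m + L).
have pw : prob_weights (fun _ : index => t) by [].
have -> : pr t (bonds 0 L) (exitsum S) = pr t J (exitsum S).
  apply: avg_supported; apply: exitsum_supported => x /SL; lia.
have -> : t * pr t J (exitsum S) * parm t m = \sum_(x <- S) \sum_(d <- dirs)
    (nb x d \notin S)%:R * (t * parm t m * pr t J (ind R (inner S x))).
  rewrite /exitsum /pr avg_sum mulrAC big_distrr; apply: eq_bigr => x _ /=.
  rewrite avg_sum big_distrr; apply: eq_bigr => d _ /=.
  by rewrite avgZ mulrCA.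
have := avg_le J zeroconf pw (fun w => @arm_le_exits S L m w S0 SL).
rewrite -/(parm t (m + L)) => /le_trans; apply.
rewrite avg_sum big_seq [X in _ <= X]big_seq; apply: ler_sum => x xS.
rewrite avg_sum; apply: ler_sum => d _; rewrite avgZ.
have [yS|yS] := boolP (nb x d \notin S); last by rewrite !mul0r.
rewrite !mul1r avg_sum.
have xd : ed x d \in J by apply: mem_bonds; have := SL _ xS; lia.
have -> : pr t J (ind R (inner S x)) =
    \sum_(C <- fpowerset S) (x \in C)%:R * pr t J (ind R (fun u => cluster S u = C)).
  under eq_bigr do rewrite /pr -avgZ; rewrite -avg_sum; congr (avg _ _ _ _).
  apply/funext => w; rewrite (sum_ind_eq (fun C : {fset site} => (x \in C)%:R) (cluster_sub S w)).
  by rewrite in_cluster.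
rewrite big_distrr; apply: ler_sum => C _ /=; rewrite avgZ mulrCA.
have [xC|xC] := boolP (x \in C); last by rewrite !mul0r.
rewrite !mul1r avg_indepM => [|a]; last first.
  have [aC|aC] := boolP (touches C a); [right; exact: off_indep|left].
  move=> w v; rewrite !ind_and (cluster_indep S0) ?(negPf aC) ?andbF //.
  rewrite (_ : ind R _ (upd w a v) = ind R (fun u => u (ed x d)) w) //.
  rewrite /ind upd_other //; apply: contraNneq aC => <-; by rewrite touches_ed xC.
under [X in avg _ _ X _ * _]funext do rewrite ind_and.
rewrite avg_indepM => [|a]; last first.
  have [aS|aS] := boolP (within S a); [right|left].
    move=> w v; rewrite /ind upd_other //; apply: contraTneq aS => <-.
    by rewrite within_ed (negPf yS) andbF.
  by apply: cluster_indep; rewrite // (negPf aS).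
rewrite -!/(pr _ _ _) pr_open // [X in _ <= X]mulrC mulrA.
have p0 : 0 <= pr t J (ind R (fun u => cluster S u = C)).
  by apply: avg_ge0 => // u; exact: ind_ge0.
apply: ler_wpM2l; first by case/andP: t01 => t0 _; rewrite mulr_ge0.
have e : (dist 0%R (nb x d) + m <= m + L)%N.
  by have := SL _ xS; have := dist_nbl 0 x d; lia.
rewrite -(pr_arm t e); apply: avg_le => // u; apply: ind_le => -[z [zm yz]].
by exists z; split => //; apply: reach_link_in_sub yz => ? [].
Qed.

End Exit.

Lemma bernoulli_ineq (R : realFieldType) (h : R) k : 0 <= h -> 1 + k%:R * h <= (1 + h) ^+ k.
Proof.
move=> h0; elim: k => [|k IH]; first by rewrite mul0r addr0 expr0.
rewrite exprS; apply: (@le_trans _ _ ((1 + h) * (1 + k%:R * h))); last first.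
  by apply: ler_wpM2l => //; lra.
rewrite -natr1; have : 0 <= k%:R * h * h by rewrite !mulr_ge0.
lra.
Qed.

(** Bernoulli's inequality for 1/c = 1 + h gives linear growth only; an even exponent squares it,
    and quadratic growth beats the linear factor. *)
Lemma geometric_beats_linear (R : archiRealFieldType) (c L : R) : 0 < c < 1 ->
  exists2 k : nat, (0 < k)%N & k%:R * L * c ^+ k < 1 / 2.
Proof.
move=> /andP[c0 c1]; pose h := c^-1 - 1.
have hE : 1 + h = c^-1 by rewrite /h addrC subrK.
have h0 : 0 < h by rewrite subr_gt0 invf_gt1.
pose M := `|L|; have M0 : 0 <= M by exact: normr_ge0.
(* With exponent 2k the product is at most 2 |L| / (k h^2), which this threshold puts below 1/2. *)
have [k kM] : exists k : nat, 4 * M / h ^+ 2 < k%:R.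
  by exists (Num.bound (4 * M / h ^+ 2)); apply: archi_boundP; rewrite divr_ge0 // ?sqr_ge0 // mulr_ge0.
have k0 : 0 < k%:R :> R by apply: le_lt_trans kM; rewrite divr_ge0 // ?sqr_ge0 // mulr_ge0.
exists k.*2; first by rewrite double_gt0 -(ltr0n R).
have kh0 : 0 < k%:R * h by rewrite mulr_gt0.
have b : k%:R * h * (k%:R * h) <= (c ^+ k.*2)^-1.
  have b1 : k%:R * h <= c^-1 ^+ k.
    by have := bernoulli_ineq k (ltW h0); rewrite hE; lra.
  rewrite -exprVn -addnn exprD; apply: ler_pM => //; exact: ltW.
have ck0 : 0 < c ^+ k.*2 by rewrite exprn_gt0.
have b2 : c ^+ k.*2 * (k%:R * h * (k%:R * h)) <= 1.
  by rewrite -ler_pdivlMl // mulr1.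
have b3 : c ^+ k.*2 <= (k%:R * h * (k%:R * h))^-1.
  by rewrite -[leRHS]mul1r ler_pdivlMr ?mulr_gt0.
have kk : k.*2%:R = 2 * k%:R :> R by rewrite -muln2 natrM mulrC.
rewrite kk; apply: (@le_lt_trans _ _ (2 * k%:R * M * (k%:R * h * (k%:R * h))^-1)).
  apply: (@le_trans _ _ (2 * k%:R * M * c ^+ k.*2)).
    by rewrite ler_pM2r // ler_pM2l ?mulr_gt0 // ler_norm.
  by apply: ler_wpM2l b3; rewrite !mulr_ge0 // ltW.
rewrite ltr_pdivrMr ?mulr_gt0 //.
have kM' : 4 * M < k%:R * h ^+ 2 by rewrite -ltr_pdivrMr // exprn_gt0.
have := kM'; rewrite -(ltr_pM2l k0) expr2; lra.
Qed.

Section Phi.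
Variable R : realType.

Lemma parm_le1 (t : R) m : 0 <= t <= 1 -> parm t m <= 1.
Proof.
move=> t01; rewrite -(avg_cst (fun=> t) (bonds 0 m) 1 zeroconf).
by apply: avg_le => // u; rewrite /ind; case: (`[< _ >]).
Qed.

Lemma phi_ge1 (t : R) (S : {fset site}) L : 1 / 2 <= t <= 1 -> 0 \in S ->
  (forall x, x \in S -> (dist 0%R x < L)%N) ->
  1 <= t * pr t (bonds 0 L) (exitsum R S).
Proof.
move=> t01 S0 SL; set phi := t * _; rewrite leNgt; apply/negP => phi1.
have t01' : 0 <= t <= 1 by lra.
(* The maximum keeps the rate positive, as [geometric_beats_linear] inverts it. *)
pose c := Num.max phi (1 / 2).
have c01 : 0 < c < 1 by rewrite /c lt_max gt_max phi1; lra.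
have decay k : parm t (k * L) <= c ^+ k.
  elim: k => [|k IH]; first by rewrite expr0 parm_le1.
  rewrite mulSnr; apply: le_trans (parm_decay _ t01' S0 SL) _.
  rewrite exprS; apply: ler_pM => //.
  - by rewrite mulr_ge0 ?avg_ge0 // => [|u]; [lra|exact: exitsum_ge0].
  - by apply: avg_ge0 => // u; exact: ind_ge0.
  - by rewrite le_max lexx.
have [k k0] := geometric_beats_linear L%:R c01; rewrite ltNge => /negP; apply.
have L0 : (0 < L)%N by apply: leq_ltn_trans (SL _ S0).
have kL : (0 < k * L)%N by rewrite muln_gt0 k0.
have := parm_ge (k * L).-1 t01; rewrite prednK // => /le_trans; apply.
by rewrite -natrM; apply: ler_wpM2l.
Qed.

End Phi.

(** * The differential inequality for the arm probability *)

Section MeanField.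
Variables (R : realFieldType) (N : nat).
Hypothesis N0 : (0 < N)%N.

Let J := bonds 0 N.
Let B (u : site) := (dist 0%R u <= N)%N.
Let f := ind R (arm 0 N).

Definition out x w := exists v, dist 0%R v = N /\ reach (link_in B w) x v.

Definition inside : {fset site} := [fset x in box 0 N | (dist 0%R x < N)%N]%fset.

Definition blocked w : {fset site} :=
  [fset x in box 0 N | (dist 0%R x < N)%N && ~~ `[< out x w >]]%fset.

Lemma in_inside x : (x \in inside) = (dist 0%R x < N)%N.
Proof.
rewrite in_fset -[LHS]/((x \in box 0 N) && _).
by apply: andb_idl => xN; apply: mem_box; exact: ltnW.
Qed.

Lemma in_blocked x w : (x \in blocked w) = (dist 0%R x < N)%N && ~~ `[< out x w >].
Proof.
rewrite in_fset -[LHS]/((x \in box 0 N) && _).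
by apply: andb_idl => /andP[xN _]; apply: mem_box; exact: ltnW.
Qed.

Lemma blocked_sub w : (blocked w `<=` inside)%fset.
Proof. by apply/fsubsetP => x; rewrite in_blocked in_inside => /andP[]. Qed.

Lemma notin_blocked x w : B x -> x \notin blocked w -> out x w.
Proof.
move=> Bx; rewrite in_blocked negb_and negbK => /orP[|/asboolP//].
rewrite -leqNgt => Nx; exists x; split; last exact: reach_refl.
by apply/eqP; rewrite eqn_leq Nx andbT.
Qed.

Lemma out_step w u v : link_in B w u v -> out u w -> out v w.
Proof.
move=> uv [z [zN uz]]; exists z; split => //.
apply: reach_trans uz; apply: reach_step (reach_refl _ _) _; exact: link_in_sym.
Qed.

(** The blocked set is found by exploring from the sphere, which reveals only bonds with an end off
    [S]. *)
Lemma blocked_indep S a : within S a -> indep_of a (ind R (fun w => blocked w = S)).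
Proof.
move=> aS; apply: indep_ind => w v wS.
have na u d : u \notin S -> ed u d != a.
  by move=> uS; apply: contraTneq aS => <-; rewrite within_ed (negPf uS).
apply/fsetP => x; rewrite -wS !in_blocked; case: ltnP => //= xN; congr (~~ _).
apply: asbool_equiv_eq; split=> -[z [zN xz]]; exists z; split => //.
  (* Paths are read from the sphere inwards: every site from which a step is taken is unblocked, so
     the bond used is not [a]. *)
  have zx : reach (link_in B (upd w a v)) z x by apply: reach_sym xz => ? ?; exact: link_in_sym.
  apply: reach_sym; first by move=> ? ?; exact: link_in_sym.
  have zout : out z w by exists z; split => //; exact: reach_refl.
  have [] // : reach (link_in B w) z x /\ out x w.
  apply: (reach_inv (I := fun u => reach (link_in B w) z u /\ out u w)) zx.
    by split => //; exact: reach_refl.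
  move=> u u' _ [zu uout] [Bu Bu' [d [du wd]]].
  have uS : u \notin S by rewrite -wS in_blocked (asboolT uout) andbF.
  have l : link_in B w u u'.
    by split => //; exists d; split => //; rewrite upd_other ?na in wd.
  by split; [exact: reach_step l|exact: out_step l _].
have zx : reach (link_in B w) z x by apply: reach_sym xz => ? ?; exact: link_in_sym.
apply: reach_sym; first by move=> ? ?; exact: link_in_sym.
apply: (reach_inv (I := fun u => reach (link_in B (upd w a v)) z u)) zx; first exact: reach_refl.
move=> u u' zu zu' [Bu Bu' [d [du wd]]].
have uout : out u w.
  by exists z; split => //; apply: reach_sym zu => ? ?; exact: link_in_sym.
have uS : u \notin S by rewrite -wS in_blocked (asboolT uout) andbF.
by apply: reach_step zu' _; split => //; exists d; split => //; rewrite upd_other ?na.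
Qed.

Lemma delta_ge0 (g : conf -> R) a w :
  (forall u u' : conf, (forall b, u b -> u' b) -> g u <= g u') -> 0 <= delta a g w.
Proof.
move=> gm; rewrite subr_ge0; apply: gm => b.
by rewrite /upd; case: eqP.
Qed.

Lemma arm_delta_ge0 a w : 0 <= delta a f w.
Proof. by apply: delta_ge0 => u u' uu'; apply: ind_le; exact: arm_incr. Qed.

(** The bond is closed, as otherwise [x] would be joined to the sphere through it; opening it links
    0 to [x] within the blocked set and then to the sphere. *)
Lemma blocked_pivotal w x d : 0 \in blocked w -> x \in blocked w -> B (nb x d) ->
  nb x d \notin blocked w -> inner (blocked w) x w ->
  ~~ w (ed x d) /\ delta (ed x d) f w = 1.
Proof.
move=> b0 xb Bd db xI.
have Bx : B x by move: xb; rewrite in_blocked => /andP[/ltnW].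
have [v [vN dv]] := notin_blocked Bd db.
have xd : ~~ w (ed x d).
  apply/negP => wd; have := xb; rewrite in_blocked => /andP[_ /asboolP]; apply.
  apply: (@out_step _ (nb x d)); last by exists v.
  by apply: link_in_sym; split => //; exists d.
split => //; rewrite /delta (upd_idv (v := false)); last exact/negbTE.
rewrite /f ind1 ?ind0 ?subr0 //.
  by move: b0; rewrite in_blocked => /andP[_ /asboolP].
have le : forall a, w a -> upd w (ed x d) true a by move=> a; rewrite /upd; case: eqP.
exists v; split => //; apply: reach_trans (reach_incr le dv).
apply: (@reach_step _ _ _ x); last by split => //; exists d; rewrite upd_same.
apply: reach_incr le _; apply: reach_link_in_sub xI => u.
by rewrite in_blocked => /andP[/ltnW].
Qed.

(** Every exit of the blocked set is a closed pivotal bond, and only one end of such a bond is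
    blocked, so none is counted twice. *)
Lemma exits_le_pivotal w : 0 \in blocked w ->
  exitsum R (blocked w) w <= \sum_(e <- J) (~~ w e)%:R * delta e f w.
Proof.
move=> b0; set S := blocked w.
pose h x d : R := (x \in S)%:R * ((nb x d \notin S)%:R * ind R (inner S x) w).
have G0 e : 0 <= (~~ w e)%:R * delta e f w by rewrite mulr_ge0 ?ler0n ?arm_delta_ge0.
have hG x d : h x d <= (~~ w (ed x d))%:R * delta (ed x d) f w.
  have [xS|xS] := boolP (x \in S); last by rewrite /h (negPf xS) mul0r.
  have [dS|dS] := boolP (nb x d \notin S); last by rewrite /h (negPf dS) mul0r mulr0.
  have [xI|xI] := pselect (inner S x w); last by rewrite /h ind0 // !mulr0.
  have Bd : B (nb x d).
    by move: xS; rewrite in_blocked => /andP[xN _]; have := dist_nbl 0 x d; rewrite /B; lia.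
  have [-> ->] := blocked_pivotal b0 xS Bd dS xI.
  by rewrite /h xS dS ind1 // !mulr1.
apply: (@le_trans _ _ (\sum_(x <- box 0 N) \sum_(d <- dirs) h x d)).
  rewrite /exitsum big_seq (eq_bigr (fun x => \sum_(d <- dirs) h x d)); last first.
    by move=> x xS; apply: eq_bigr => d _; rewrite /h xS mul1r.
  rewrite -big_seq; apply: sum_uniq_sub; [|exact: fset_uniq|].
    by move=> x; apply: sumr_ge0 => d _; rewrite !mulr_ge0 ?ind_ge0 ?ler0n.
  by move=> x; rewrite in_blocked => /andP[xN _]; apply: mem_box; exact: ltnW.
apply: sum_dirs_le => [x d|x v]; first by rewrite !mulr_ge0 ?ind_ge0 ?ler0n.
have [xS|xS] := boolP (x \in S).
  rewrite [X in _ + X](_ : _ = 0) ?addr0 //.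
  by rewrite /h (nbK x (v, true)) xS mul0r mulr0.
rewrite [X in X + _](_ : _ = 0) ?add0r; last by rewrite /h (negPf xS) mul0r.
have := hG (nb x (v, true)) (v, false).
by rewrite (ed_opp x (v, true)).
Qed.

(** The failure of the arm is split according to the value S of [blocked], and the hypothesis
    inserts t times the expected exits of S. The inside of S is independent of the event that S is
    the blocked set, so the product recombines into the exits of the blocked set itself. The factor
    1 - t comes from the pivotal bonds being closed. *)
Lemma mean_field (t : R) : 0 <= t <= 1 ->
  (forall S : {fset site}, 0 \in S -> (forall x, x \in S -> (dist 0%R x < N)%N) ->
     1 <= t * pr t J (exitsum R S)) ->
  1 - parm t N <= t * (1 - t) * \sum_(e <- J) pr t J (delta e f).
Proof.
move=> t01 phi1.
have pw : prob_weights (fun _ : index => t) by [].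
have -> : 1 - parm t N = \sum_(S <- fpowerset inside)
    (0 \in S)%:R * pr t J (ind R (fun u => blocked u = S)).
  rewrite /parm -[X in X - _](avg_cst (fun=> t) J 1 zeroconf) /pr -avgB.
  under eq_bigr do rewrite -avgZ; rewrite -avg_sum; congr (avg _ _ _ _).
  apply/funext => w.
  rewrite (sum_ind_eq (fun S : {fset site} => (0 \in S)%:R) (blocked_sub w)).
  rewrite in_blocked distxx N0 /= /ind.
  rewrite (_ : `[< out 0 w >] = `[< arm 0 N w >]) //.
  by case: (`[< _ >]); rewrite ?subrr ?subr0.
apply: (@le_trans _ _ (t * pr t J (fun w => \sum_(S <- fpowerset inside)
    ((0 \in S)%:R * exitsum R S w) * ind R (fun u => blocked u = S) w))).
  rewrite /pr avg_sum big_distrr /= big_seq [X in _ <= X]big_seq.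
  apply: ler_sum => S; rewrite fpowersetE => /fsubsetP Sin.
  have -> : avg (fun=> t) J (fun w => (0 \in S)%:R * exitsum R S w *
        ind R (fun u => blocked u = S) w) zeroconf =
      (0 \in S)%:R * (pr t J (exitsum R S) * pr t J (ind R (fun u => blocked u = S))).
    rewrite /pr -avg_indepM => [|a]; last first.
      by have [aS|aS] := boolP (within S a);
        [right; exact: blocked_indep|left; exact: exitsum_indep].
    by rewrite -avgZ; congr (avg _ _ _ _); apply/funext => w; rewrite mulrA.
  rewrite mulrCA; have [S0|] := boolP (0 \in S); last by rewrite !mul0r.
  rewrite !mul1r mulrA ler_peMl //; first by apply: avg_ge0 => // u; exact: ind_ge0.
  by apply: phi1 => // x /Sin; rewrite in_inside.
rewrite -mulrA; apply: ler_wpM2l; first by case/andP: t01.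
have -> : (1 - t) * (\sum_(e <- J) pr t J (delta e f)) =
    pr t J (fun w => \sum_(e <- J) (~~ w e)%:R * delta e f w).
  rewrite /pr avg_sum big_distrr big_seq [RHS]big_seq.
  by apply: eq_bigr => e eJ /=; rewrite (avg_closed _ _ _ eJ).
apply: avg_le => // w.
rewrite (sum_ind_eq (fun S : {fset site} => (0 \in S)%:R * exitsum R S w) (blocked_sub w)).
have [b0|_] := boolP (0 \in blocked w); last first.
  rewrite mul0r; apply: sumr_ge0 => e _; by rewrite mulr_ge0 ?ler0n ?arm_delta_ge0.
by rewrite mul1r exits_le_pivotal.
Qed.

End MeanField.

(** * Russo's formula *)

Lemma avg_delta (R : realFieldType) (T : eqType) (p : T -> R) J a f w : a \notin J ->
  avg p J (delta a f) w = avg p J f (upd w a true) - avg p J f (upd w a false).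
Proof.
elim: J w => //= b J IH w; rewrite inE negb_or => /andP[ab aJ].
by rewrite /avg1 !IH // !(@updC _ w b a) 1?eq_sym //; ring.
Qed.

(** Russo's formula along a curve of weights: [avg] is affine in each weight, with slope the average
    of [delta]. A repeated coordinate would be counted twice in the sum, hence [uniq J]. *)
Lemma is_derive_avg (R : realType) (T : eqType) (p : R -> T -> R) (p' : T -> R) (t : R) J f w :
  uniq J -> (forall a, a \in J -> is_derive t 1 (p ^~ a) (p' a)) ->
  is_derive t 1 (fun s => avg (p s) J f w)
    (\sum_(a <- J) p' a * avg (p t) J (delta a f) w).
Proof.
elim: J w => [|a J IH] w /=.
  by move=> _ _; rewrite big_nil; exact: is_derive_cst.
move=> /andP[aJ uJ] dp.
have da : is_derive t 1 (p ^~ a) (p' a) by apply: dp; rewrite mem_head.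
have dJ u : is_derive t 1 (fun s => avg (p s) J f u) (\sum_(b <- J) p' b * avg (p t) J (delta b f) u).
  by apply: IH => // b bJ; apply: dp; rewrite inE bJ orbT.
have d1 := dJ (upd w a true); have d0 := dJ (upd w a false).
have dM : is_derive t 1 (fun s => p s a * avg (p s) J f (upd w a true) +
    (1 - p s a) * avg (p s) J f (upd w a false)) _ :=
  is_deriveD (is_deriveM da d1) (is_deriveM (is_deriveB (is_derive_cst (1 : R) t 1) da) d0).
apply: is_derive_eq dM _.
rewrite big_cons /avg1 !avg_delta // !upd_upd /GRing.scale /=.
have -> : \sum_(b <- J) p' b * (p t a * avg (p t) J (delta b f) (upd w a true) +
      (1 - p t a) * avg (p t) J (delta b f) (upd w a false)) =
    p t a * \sum_(b <- J) p' b * avg (p t) J (delta b f) (upd w a true) +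
    (1 - p t a) * \sum_(b <- J) p' b * avg (p t) J (delta b f) (upd w a false).
  rewrite !big_distrr -big_split; apply: eq_bigr => b _ /=; ring.
rewrite -[(cst 1 - p ^~ a) t]/(1 - p t a); ring.
Qed.

Lemma le_of_is_derive_ge0 (R : realType) (f df : R -> R) (a b : R) : a <= b ->
  (forall x, a <= x <= b -> is_derive x 1 f (df x)) ->
  (forall x, a <= x <= b -> 0 <= df x) -> f a <= f b.
Proof.
move=> ab dfx df0; apply: (@ger0_derive1_le_cc _ f a b) => //.
- move=> x; rewrite in_itv /= => /andP[ax xb]; have h : a <= x <= b by rewrite !ltW.
  exact: (@ex_derive _ _ _ _ _ _ _ (dfx x h)).
- move=> x; rewrite in_itv /= => /andP[ax xb]; have h : a <= x <= b by rewrite !ltW.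
  by rewrite derive1E (@derive_val _ _ _ _ _ _ _ (dfx x h)) df0.
- apply: derivable_within_continuous => x; rewrite in_itv /= => h.
  exact: (@ex_derive _ _ _ _ _ _ _ (dfx x h)).
- by rewrite in_itv /= lexx.
- by rewrite in_itv /= lexx andbT.
Qed.

Lemma parm_lower (R : realType) (b : R) N : 1 / 2 <= b < 1 -> (0 < N)%N ->
  1 - 1 / (2 * b) <= parm b N.
Proof.
move=> b12 N0; pose J := bonds 0 N; pose f := ind R (arm 0 N).
pose dF (t : R) := \sum_(e <- J) (1 : R) * pr t J (delta e f).
have dparm (t : R) : is_derive t 1 (fun s => parm s N) (dF t).
  by apply: is_derive_avg; exact: undup_uniq.
pose dG (t : R) := - ((1 - parm t N) + t * (- dF t)).
(* The quantity -t (1 - F) has derivative t F' - (1 - F), and 1 - F <= t F'. *)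
pose G (t : R) : R := - (t * (1 - parm t N)).
have dGP (t : R) : is_derive t 1 G (dG t).
  apply: is_derive_eq (is_deriveN (is_deriveM (is_derive_id t 1)
    (is_deriveB (is_derive_cst (1 : R) t 1) (dparm t)))) _.
  by rewrite /dG /GRing.scale /= -[(cst 1 - _) t]/(1 - parm t N); ring.
have : G (1 / 2) <= G b.
  apply: (@le_of_is_derive_ge0 _ G dG); [lra|move=> x xb].
  have x01 : 0 <= x <= 1 by lra.
  have phi1 (S : {fset site}) : 0 \in S -> (forall u, u \in S -> (dist 0%R u < N)%N) ->
      1 <= x * pr x J (exitsum R S).
    by move=> S0 SN; apply: phi_ge1; rewrite // ; lra.
  have := mean_field N0 x01 phi1; rewrite -/J -/f.
  have -> : \sum_(e <- J) pr x J (delta e f) = dF x.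
    by apply: eq_bigr => e _; rewrite mul1r.
  have F0 : 0 <= dF x.
    apply: sumr_ge0 => e _; rewrite mul1r; apply: avg_ge0 => // u; exact: arm_delta_ge0.
  (* This is the slack x^2 F' between x F' and x (1 - x) F'. *)
  have := mulr_ge0 (mulr_ge0 (ltac:(lra) : 0 <= x) (ltac:(lra) : 0 <= x)) F0.
  rewrite /dG; lra.
have h0 : 0 <= parm (1 / 2 : R) N.
  have pw : prob_weights (fun _ : index => 1 / 2 : R) by move=> _; lra.
  by apply: avg_ge0 => // u; exact: ind_ge0.
rewrite /G => h; rewrite lerBlDr -lerBlDl ler_pdivlMr; last lra.
lra.
Qed.

(** * Mixed percolation *)

Definition mixed_weight (R : realFieldType) (s t : R) (a : index) : R :=
  if a is inl _ then s else t.

Lemma mixed_weightP (R : realFieldType) (s t : R) : 0 <= s <= 1 -> 0 <= t <= 1 ->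
  prob_weights (mixed_weight s t).
Proof. by move=> s01 t01 []. Qed.

Section Mixed.
Variable N : nat.

(* The origin and the sphere need not be open; sites outside the ball are
   discarded. *)
Definition usable (w : conf) (u : site) : Prop :=
  [\/ u = 0, dist 0 u = N | (dist 0%R u < N)%N /\ w (inl u)].

Definition joined (w : conf) : Prop :=
  exists v, dist 0%R v = N /\ reach (link_in (usable w) w) 0 v.

Definition mixed_indices : seq index := map inl (box 0 N) ++ bonds 0 N.

Lemma uniq_mixed_indices : uniq mixed_indices.
Proof.
rewrite cat_uniq map_inj_uniq ?box_uniq; last by move=> ? ? [].
rewrite undup_uniq andbT; apply/hasPn => a /bonds_inr[k ->].
by apply/negP => /mapP[].
Qed.

Lemma usable_dist w u : usable w u -> (dist 0%R u <= N)%N.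
Proof. by case=> [->|->//|[/ltnW]]; rewrite ?distxx. Qed.

Lemma joined_supported (R : realFieldType) : supported mixed_indices (ind R joined).
Proof.
apply: supported_ind => w w' ww' [v [vN jv]]; exists v; split => //.
apply: (@reach_link_in_sub (usable w)) => [u uw|].
  case: (uw) => [->|uN|[uN wu]]; [exact: Or31|exact: Or32|apply: Or33; split => //].
  rewrite -ww' // mem_cat; apply/orP; left; apply: map_f; apply: mem_box; exact: ltnW.
apply: reach_link_in_eq jv => u d /usable_dist uN _.
by rewrite ww' // mem_cat mem_bonds ?orbT.
Qed.

Lemma joined_incr (w w' : conf) : (forall a, w a -> w' a) -> joined w -> joined w'.
Proof.
move=> ww' [v [vN jv]]; exists v; split => //; apply: (reach_incr ww').
apply: reach_link_in_sub jv => u [->|uN|[uN wu]]; [exact: Or31|exact: Or32|apply: Or33].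
by split => //; exact: ww'.
Qed.

Lemma pivotalE (R : realFieldType) (a : index) (w : conf) :
  (w a)%:R * delta a (ind R joined) w =
  ind R (fun w => [/\ w a, joined w & ~ joined (upd w a false)]) w.
Proof.
have [wa|wa] := boolP (w a); last by rewrite mul0r ind0 // => -[]; rewrite (negPf wa).
rewrite mul1r /delta (upd_idv wa).
have [jw'|jw'] := pselect (joined (upd w a false)).
  rewrite [RHS]ind0 => [|[_ _ /(_ jw')//]]; rewrite !ind1 ?subrr //.
  by apply: joined_incr jw' => b; rewrite /upd; case: eqP.
have [jw|jw] := pselect (joined w); first by rewrite ind1 // ind0 // subr0 ind1.
by rewrite ind0 // ind0 // subr0 ind0 // => -[].
Qed.

Lemma joined_delta_ge0 (R : realFieldType) (a : index) (w : conf) : 0 <= delta a (ind R joined) w.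
Proof. by apply: delta_ge0 => u u' uu'; apply: ind_le; exact: joined_incr. Qed.

Lemma joined_indep (R : realFieldType) (x : site) : ~~ ((x != 0) && (dist 0%R x < N)%N) ->
  indep_of (inl x : index) (ind R joined).
Proof.
move=> hx; apply: indep_ind => w v [z [zN zj]]; exists z; split => //.
apply: reach_upd => //; apply: reach_link_in_sub zj => u.
case=> [->|uN|[uN wu]]; [exact: Or31|exact: Or32|].
have [xu|xu] := eqVneq u x; last by apply: Or33; split => //; rewrite upd_other.
by rewrite xu in uN *; move: hx; rewrite uN andbT negbK => /eqP ->; exact: Or31.
Qed.

(** * Charging a pivotal site to its incident bonds *)

Section Site.
Variable x : site.
Hypotheses (x0 : x <> 0) (xN : (dist 0%R x < N)%N).

Let away w (u : site) := usable w u /\ u <> x.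
(** [P] and [Q] are the two halves of a connection through [x]; avoiding [x], they do not see its
    four bonds, whose states can thus be changed freely. *)
Let P w d := reach (link_in (away w) w) 0 (nb x d).
Let Q w d := exists v, dist 0%R v = N /\ reach (link_in (away w) w) (nb x d) v.
Let closed w := upd w (inl x : index) false.

Lemma usable_away w u : usable (closed w) u <-> away w u.
Proof.
split=> [h|[h ux]].
  case: (h) => [->|uN|[uN]]; [split; [exact: Or31|by apply/nesym]|split; [exact: Or32|]|].
    by move=> ux; have := xN; rewrite -ux uN ltnn.
  have [->|ux] := eqVneq u x; first by rewrite /closed upd_same.
  rewrite /closed upd_other // => wu; split; last exact/eqP.
  by apply: Or33.
case: h => [->|uN|[uN wu]]; [exact: Or31|exact: Or32|apply: Or33; split => //].
by rewrite /closed upd_other //; apply/eqP => -[].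
Qed.

Lemma reach_closed w u v : reach (link_in (usable (closed w)) (closed w)) u v <->
  reach (link_in (away w) w) u v.
Proof.
split=> h.
  apply: (@reach_link_in_sub (usable (closed w))) => [z /usable_away//|].
  by apply: reach_link_in_eq h => z d _ _; rewrite /closed upd_other.
apply: (@reach_link_in_sub (away w)) => [z /usable_away//|].
by apply: reach_link_in_eq h => z d _ _; rewrite /closed upd_other.
Qed.

Lemma ed_neq u d d' : u <> x -> nb u d <> x -> ed u d != ed x d'.
Proof.
move=> ux dx; apply/eqP => e.
have := within_ed [fset x]%fset u d; have := within_ed [fset u; nb u d]%fset x d'.
rewrite -e !within_ed !inE !eqxx /= orbT /= => /esym/andP[].
by move=> /orP[/eqP h|/eqP h]; [case: ux|case: dx].
Qed.

Lemma reach_away_upd w d v u z :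
  reach (link_in (away (upd w (ed x d) v)) (upd w (ed x d) v)) u z ->
  reach (link_in (away w) w) u z.
Proof.
move=> h; apply: (@reach_link_in_sub (away (upd w (ed x d) v))).
  by move=> y [[->|yN|[yN wy]] yx]; split => //; [exact: Or31|exact: Or32|exact: Or33].
apply: reach_link_in_eq h => y d' [_ yx] [_ y'x].
by rewrite upd_other // ed_neq.
Qed.

Lemma joined_split w : joined w -> joined (closed w) \/
  exists a b, [/\ P w a, Q w b, w (ed x a) & w (ed x b)].
Proof.
move=> [v [vN jv]].
have vx : v <> x by move=> vx; have := xN; rewrite -vx vN ltnn.
have [h|[a [b [h1 h2 h3 h4 _]]]] := reach_split jv x0 vx.
  by left; exists v; split => //; apply/reach_closed.
by right; exists a, b; split => //; exists v.
Qed.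

Lemma joined_of_PQ w a : P w a -> Q w a -> joined (closed w).
Proof.
by move=> Pa [v [vN Qa]]; exists v; split => //; apply/reach_closed; exact: reach_trans Qa.
Qed.

Lemma joined_closed_upd w d v : joined (closed (upd w (ed x d) v)) -> joined (closed w).
Proof.
move=> [z [zN /reach_closed h]]; exists z; split => //; apply/reach_closed.
exact: reach_away_upd h.
Qed.

Definition site_pivotal (w : conf) := [/\ w (inl x), joined w & ~ joined (closed w)].

Definition bond_pivotal d (w : conf) :=
  [/\ w (ed x d), joined w & ~ joined (upd w (ed x d) false)].

(* Otherwise there are two open bonds at x leading to the origin off x, and two
   others leading to the sphere off x, so that all four are open. *)
Lemma exists_bond_pivotal w d0 : site_pivotal w -> ~~ w (ed x d0) ->
  exists d, bond_pivotal d w.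
Proof.
move=> [wx jw njw] wd0; apply: contrapT => nb_piv.
have H d : w (ed x d) -> exists a b, [/\ P w a, Q w b, w (ed x a) & w (ed x b)] /\ a != d /\ b != d.
  move=> wd; have [|] := pselect (joined (upd w (ed x d) false)); last first.
    by move=> nj; case: nb_piv; exists d.
  move=> /joined_split[/joined_closed_upd//|[a [b [Pa Qb wa wb]]]].
  exists a, b; have neq c : upd w (ed x d) false (ed x c) -> c != d /\ w (ed x c).
    have [->|cd] := eqVneq c d; first by rewrite upd_same.
    by rewrite /upd; case: eqP.
  have [ad wa'] := neq _ wa; have [bd wb'] := neq _ wb.
  split => //; split => //; first exact: reach_away_upd Pa.
  by case: Qb => v [vN Qv]; exists v; split => //; exact: reach_away_upd Qv.
have PQ a b : P w a -> Q w b -> a != b.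
  by move=> Pa Qb; apply/eqP => ab; rewrite -ab in Qb; exact: njw (joined_of_PQ Pa Qb).
have op a : w (ed x a) -> a != d0 by move=> wa; apply: contraTneq wa => ->.
have [//|[a [b [Pa Qb wa wb]]]] := joined_split jw.
have [a1 [_ [[Pa1 _ wa1 _] [a1a _]]]] := H a wa.
have [_ [b1 [[_ Qb1 _ wb1] [_ b1b]]]] := H b wb.
have : uniq [:: a1; a; b1; b; d0].
  by rewrite /= !inE !negb_or a1a b1b (PQ a1 b1) // (PQ a1 b) // (PQ a b1) // (PQ a b) //
    (op a1) // (op a) // (op b1) // (op b).
by move=> /uniq_leq_size/(_ (fun d _ => mem_dirs d)).
Qed.

Lemma ed_inj d d' : ed x d = ed x d' -> d = d'.
Proof.
by case: (x) d d' => x1 x2 [[] []] [[] []] //= [] //; lia.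
Qed.

Definition all_but d (w : conf) : bool := all (fun d' => w (ed x d') == (d' != d)) dirs.

Variables (R : realFieldType) (s t : R).
Hypotheses (s01 : 0 <= s <= 1) (t01 : 0 <= t <= 1).

Let f := ind R joined.
Let X := ind R site_pivotal.
Let Y (u : conf) := \sum_(d <- dirs) ind R (bond_pivotal d) u.
Let Z := ind R (fun u => [/\ site_pivotal u, forall d, u (ed x d) &
  forall d, ~ bond_pivotal d u]).

Let Y0 u : 0 <= Y u.
Proof. by apply: sumr_ge0 => d _; exact: ind_ge0. Qed.

Let Y1 u d : bond_pivotal d u -> 1 <= Y u.
Proof.
move=> du; rewrite -(ind1 R (A := bond_pivotal d) du).
apply: (sum_ge_term (F := fun d => ind R (bond_pivotal d) u)) (mem_dirs d) => ?.
exact: ind_ge0.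
Qed.

Lemma site_pivotal_le u : X u <= Y u + Z u.
Proof.
have [Xu|Xu] := pselect (site_pivotal u); last first.
  by rewrite /X ind0 // addr_ge0 ?ind_ge0.
have [[d du]|nd] := pselect (exists d, bond_pivotal d u).
  by rewrite /X ind1 //; apply: le_trans (Y1 du) _; rewrite lerDl ind_ge0.
rewrite /X ind1 // /Z ind1 ?lerDr //; split => // d; last by move=> du; apply: nd; exists d.
by apply: contrapT => /negP /(exists_bond_pivotal Xu).
Qed.

Lemma sum_all_but u : \sum_(d <- dirs) (all_but d u)%:R <= 1 :> R.
Proof.
rewrite /all_but /dirs !big_cons big_nil /=.
by case: (u _); case: (u _); case: (u _); case: (u _) => /=; lra.
Qed.

(** In a configuration counted by [Z] the bond in direction [d] is not pivotal, so closing it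
    preserves the connection and the pivotality of [x]; as [x] now has a closed bond, some incident
    bond is open and pivotal. The new configuration remembers [d] as the only closed direction. *)
Lemma all_open_le u d (u' := upd u (ed x d) false) :
  Z u <= (u (ed x d))%:R * ((all_but d u')%:R * Y u').
Proof.
have [[[ux ju nju] ou npu]|nZ] := pselect [/\ site_pivotal u, forall d, u (ed x d) &
  forall d, ~ bond_pivotal d u]; last first.
  by rewrite /Z ind0 // !mulr_ge0 ?ler0n.
have Xu' : site_pivotal u'.
  split; first by rewrite /u' upd_other.
    by apply: contrapT => nju'; apply: (npu d).
  by move=> /joined_closed_upd.
have ud : ~~ u' (ed x d) by rewrite /u' upd_same.
have [d' du'] := exists_bond_pivotal Xu' ud.
have -> : all_but d u'.
  apply/allP => e _; rewrite /u'; have [->|ed'] := eqVneq e d; first by rewrite upd_same.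
  by rewrite upd_other ?ou //; apply: contraNneq ed' => /ed_inj ->.
rewrite ou !mul1r; apply: le_trans (Y1 du').
by rewrite /Z /ind; case: (`[< _ >]).
Qed.

(** Summing [all_open_le] over the four directions, with [avg_swap] for the cost and [sum_all_but]
    for the disjointness of the images, gives 4 (1 - t) E Z <= t E Y. With E X <= E Y + E Z the
    constant on the right becomes 4 (1 - t) + t. A factor t is given away in bounding open pivotal
    bonds by pivotal ones. *)
Lemma site_le_bonds :
  4 * (1 - t) * (s * avg (mixed_weight s t) mixed_indices (delta (inl x : index) f) zeroconf) <=
  (1 + 3 * (1 - t)) *
    \sum_(d <- dirs) avg (mixed_weight s t) mixed_indices (delta (ed x d) f) zeroconf.
Proof.
set p := mixed_weight s t; set K := mixed_indices.
pose E g := avg p K g zeroconf.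
have pw : prob_weights p := mixed_weightP s01 t01.
have xK : (inl x : index) \in K.
  by rewrite mem_cat; apply/orP; left; apply: map_f; apply: mem_box; exact: ltnW.
have eK d : ed x d \in K by rewrite mem_cat mem_bonds ?orbT // ltnW.
have -> : s * avg p K (delta (inl x : index) f) zeroconf = E X.
  rewrite -[s]/(p (inl x)) -avg_open //; congr (avg _ _ _ _).
  by apply/funext => u; exact: pivotalE.
have EY : E Y <= \sum_(d <- dirs) E (delta (ed x d) f).
  rewrite /E avg_sum; apply: ler_sum => d _.
  have -> : ind R (bond_pivotal d) = fun u => (u (ed x d))%:R * delta (ed x d) f u.
    by apply/funext => u; rewrite pivotalE.
  rewrite avg_open // ler_piMl //; last by case/andP: t01.
  by apply: avg_ge0 => // u; exact: joined_delta_ge0.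
have EXYZ : E X <= E Y + E Z by rewrite /E -avgD; apply: avg_le => // u; exact: site_pivotal_le.
have EZ : 4 * (1 - t) * E Z <= t * E Y.
  have -> : 4 * (1 - t) * E Z = \sum_(d <- dirs) (1 - t) * E Z.
    by rewrite /dirs !big_cons big_nil; ring.
  apply: (@le_trans _ _ (\sum_(d <- dirs) t * E (fun u => (all_but d u)%:R * Y u))).
    apply: ler_sum => d _.
    apply: (@le_trans _ _ ((1 - t) * E (fun u => (u (ed x d))%:R *
        ((all_but d (upd u (ed x d) false))%:R * Y (upd u (ed x d) false))))).
      apply: ler_wpM2l; first by rewrite subr_ge0; case/andP: t01.
      by apply: avg_le => // u; exact: all_open_le.
    rewrite -[t]/(p (ed x d)) -(avg_swap p (fun u => (all_but d u)%:R * Y u) _ (eK d)).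
    apply: ler_wpM2l; first by case/andP: t01.
    apply: avg_le => // u; rewrite ler_piMl ?mulr_ge0 ?ler0n //.
    by case: (~~ _).
  rewrite -big_distrr /=; apply: ler_wpM2l; first by case/andP: t01.
  rewrite /E -avg_sum; apply: avg_le => // u.
  by rewrite -big_distrl /= ler_piMl // sum_all_but.
rewrite -/(E _) in EY *.
have E0 : 0 <= 1 - t by rewrite subr_ge0; case/andP: t01.
have h1 := ler_wpM2l (_ : 0 <= 4 * (1 - t)) EXYZ.
have h2 := ler_wpM2l (_ : 0 <= 1 + 3 * (1 - t)) EY.
have := h1 (ltac:(lra)); have := h2 (ltac:(lra)); rewrite -/(E _).
lra.
Qed.

End Site.

Section Slope.
Variables (R : realFieldType) (s t : R).
Hypotheses (s01 : 0 <= s <= 1) (t01 : 0 <= t <= 1).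
Let E a := avg (mixed_weight s t) mixed_indices (delta a (ind R joined)) zeroconf.

(** A bond has two ends, so the sum of the local inequalities counts it at most twice, whence 2 in
    place of 4. The origin and the sites off the open ball are never pivotal. *)
Lemma sites_le_bonds :
  2 * (1 - t) * (s * \sum_(x <- box 0 N) E (inl x)) <=
  (1 + 3 * (1 - t)) * \sum_(e <- bonds 0 N) E e.
Proof.
have pw : prob_weights (mixed_weight s t) := mixed_weightP s01 t01.
have E0 a : 0 <= E a by apply: avg_ge0 => // u; exact: joined_delta_ge0.
have c0 : 0 <= 1 + 3 * (1 - t) by case/andP: t01 => t0 t1; lra.
have h1 : 4 * (1 - t) * (s * \sum_(x <- box 0 N) E (inl x)) <=
    (1 + 3 * (1 - t)) * \sum_(x <- box 0 N) \sum_(d <- dirs) E (ed x d).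
  rewrite !big_distrr; apply: ler_sum => x _.
  have [/andP[/eqP x0 xN]|hx] := boolP ((x != 0) && (dist 0%R x < N)%N).
    exact: site_le_bonds.
  have -> : E (inl x) = 0.
    rewrite /E -[RHS](avg_cst (mixed_weight s t) mixed_indices 0 zeroconf).
    by congr (avg _ _ _ _); apply/funext => u; rewrite /delta !(joined_indep R hx) subrr.
  by rewrite /= !mulr0 mulr_ge0 //; apply: sumr_ge0 => d _.
have h2 : \sum_(x <- box 0 N) \sum_(d <- dirs) E (ed x d) <= \sum_(e <- bonds 0 N) 2 * E e.
  apply: sum_dirs_le => // x v; rewrite (ed_opp x (v, true)); lra.
have := ler_wpM2l c0 h2; rewrite -big_distrr /=; lra.
Qed.

End Slope.

(** Closed sites have weight zero here, and once all sites are open the whole ball is usable. *)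
Lemma parm_le_joined (R : realFieldType) (t : R) : 0 <= t <= 1 ->
  parm t N <= avg (mixed_weight 1 t) mixed_indices (ind R joined) zeroconf.
Proof.
move=> t01; have pw : prob_weights (mixed_weight 1 t) by apply: mixed_weightP => //; lra.
have h : supported (bonds 0 N) (ind R (arm 0 N)) by apply: arm_supported; rewrite distxx.
have hK : supported mixed_indices (ind R (arm 0 N)).
  by apply: supportedS h => a; rewrite mem_cat orbC => ->.
(* The invariant that all sites are open also concerns sites off the list, so the base configuration
   has to satisfy it. *)
rewrite (avg_supported_const _ _ (fun=> true) (joined_supported R)).
have -> : parm t N = avg (mixed_weight 1 t) mixed_indices (ind R (arm 0 N)) (fun=> true).
  rewrite (avg_supported _ _ zeroconf hK h); apply: avg_ext => a /bonds_inr[k ->] //.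
apply: (avg_le_inv _ (I := fun u => forall x, u (inl x))) => //.
- by move=> a u Iu _ x; rewrite /upd; case: eqP.
- by move=> [y|k] u Iu /=; rewrite ?eqxx // => _ x; rewrite upd_other.
move=> u Iu; apply: ind_le => -[v [vN jv]]; exists v; split => //.
apply: reach_link_in_sub jv => z; rewrite leq_eqVlt => /orP[/eqP|] h'; first exact: Or32.
exact: Or33.
Qed.

End Mixed.

(** * The curve through [(1, b0)] *)

Section Curve.
Variable R : realType.
Implicit Types (t b : R).

(** Its derivative is 3 (1 - t) / (4 - 3 t), so that 2/3 of it is the ratio of the constants in
    [sites_le_bonds]; the 5 makes it vanish at t = 1/2. *)
Definition rate t : R := t - 1 / 2 + 1 / 3 * ln ((8 - 6 * t) / 5).

Definition drate t : R := 1 - 2 / (8 - 6 * t).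

Lemma is_derive_rate t : t <= 1 -> is_derive t 1 rate (drate t).
Proof.
move=> t1; have t0 : 0 < (8 - 6 * t) / 5 by lra.
have d1 : is_derive t 1 (fun u : R => (8 - 6 * u) / 5) (- (6 / 5)).
  apply: is_derive_eq (is_deriveM (is_deriveB (is_derive_cst (8 : R) t 1)
    (is_deriveM (is_derive_cst (6 : R) t 1) (is_derive_id t 1))) (is_derive_cst (5^-1 : R) t 1)) _.
  by rewrite /GRing.scale /= /cst; lra.
have d2 := @is_derive1_comp _ (@ln R) (fun u => (8 - 6 * u) / 5) t _ _ (is_derive1_ln t0) d1.
apply: is_derive_eq (is_deriveD (is_deriveB (is_derive_id t 1) (is_derive_cst (1 / 2 : R) t 1))
  (is_deriveM (is_derive_cst (1 / 3 : R) t 1) d2)) _.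
rewrite /GRing.scale /= /cst /drate; field.
by apply/eqP; lra.
Qed.

Lemma drate_ge0 t : t <= 1 -> 0 <= drate t.
Proof. by move=> t1; rewrite /drate subr_ge0 ler_pdivrMr; lra. Qed.

Lemma rate_le t b : t <= b -> b <= 1 -> rate t <= rate b.
Proof.
move=> tb b1.
have d x : t <= x <= b -> is_derive x 1 rate (drate x).
  by move=> /andP[_ xb]; apply: is_derive_rate; lra.
have d0 x : t <= x <= b -> 0 <= drate x by move=> /andP[_ xb]; apply: drate_ge0; lra.
exact: (le_of_is_derive_ge0 tb d d0).
Qed.

Definition curve b t : R := expR (- (2 / 3) * (rate t - rate b)).

Lemma curve01 b t : b <= t -> t <= 1 -> 0 <= curve b t <= 1.
Proof.
move=> bt t1; rewrite expR_ge0 /= -[leRHS]expR0 ler_expR.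
by have := rate_le bt t1; lra.
Qed.

Lemma is_derive_curve b t : t <= 1 ->
  is_derive t 1 (curve b) (- (2 / 3) * drate t * curve b t).
Proof.
move=> t1; have d := is_derive_rate t1.
have d1 : is_derive t 1 (fun u => - (2 / 3) * (rate u - rate b)) (- (2 / 3) * drate t).
  apply: is_derive_eq (is_deriveM (is_derive_cst (- (2 / 3) : R) t 1)
    (is_deriveB d (is_derive_cst (rate b) t 1))) _.
  by rewrite /GRing.scale /= /cst; lra.
apply: is_derive_eq (@is_derive1_comp _ (@expR R) (fun u => - (2 / 3) * (rate u - rate b)) t _ _ (is_derive_expR _) d1) _.
by rewrite mulrC.
Qed.

(** Site and bond weights move together, so Russo's formula has a nonpositive site part and a
    nonnegative bond part; by the choice of the slope, [sites_le_bonds] says that the latter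
    compensates the former. *)
Lemma joined_curve_le N b0 b : 0 <= b0 -> b0 <= b -> b <= 1 ->
  avg (mixed_weight 1 b0) (mixed_indices N) (ind R (joined N)) zeroconf <=
  avg (mixed_weight (curve b0 b) b) (mixed_indices N) (ind R (joined N)) zeroconf.
Proof.
move=> b00 b0b b1; set K := mixed_indices N; set f := ind R (joined N).
pose H t := avg (mixed_weight (curve b0 t) t) K f zeroconf.
pose dp t (a : index) : R := if a is inl _ then - (2 / 3) * drate t * curve b0 t else 1.
pose dH t := \sum_(a <- K) dp t a *
  avg (mixed_weight (curve b0 t) t) K (delta a f) zeroconf.
have -> : avg (mixed_weight 1 b0) K f zeroconf = H b0.
  by rewrite /H /curve subrr mulr0 expR0.
have d t : b0 <= t <= b -> is_derive t 1 H (dH t).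
  move=> /andP[b0t tb]; apply: is_derive_avg; first exact: uniq_mixed_indices.
  by move=> [x|k] _ /=; [apply: is_derive_curve; lra|exact: is_derive_id].
suff d0 t : b0 <= t <= b -> 0 <= dH t by exact: (le_of_is_derive_ge0 b0b d d0).
move=> /andP[b0t tb].
have t01 : 0 <= t <= 1 by lra.
have t1 : t <= 1 by lra.
have s01 := curve01 b0t t1.
have := sites_le_bonds N s01 t01.
rewrite -/f -/K; set S := \sum_(x <- _) _; set B := \sum_(e <- _) _ => h.
have -> : dH t = - (2 / 3) * drate t * curve b0 t * S + B.
  rewrite /dH big_cat big_map big_distrr; congr (_ + _).
  by rewrite big_seq [RHS]big_seq; apply: eq_bigr => e /bonds_inr[k ->]; rewrite mul1r.
have c0 : 0 < 1 + 3 * (1 - t) by lra.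
have -> : - (2 / 3) * drate t = - (2 * (1 - t)) / (1 + 3 * (1 - t)).
  by rewrite /drate; field; apply/andP; split; apply/eqP; lra.
rewrite -(pmulr_rge0 _ c0) mulrDr !mulrA [(_ * (- _)) * _]mulrC !mulrA mulVf ?gt_eqF // mul1r.
by move: h; rewrite mulrA; lra.
Qed.

End Curve.

(** * From the measure to finite averages *)

Section Encoding.

Definition bond_set (k : site * bool) : {fset site} := [fset k.1; nb k.1 (k.2, true)]%fset.

Lemma norm1_nb u v : norm1 (u - v) = 1%N <-> exists d, v = nb u d.
Proof.
case: u v => u1 u2 [v1 v2]; rewrite /norm1 /=; split=> [h|[[[] []] [-> ->]] /=]; try lia.
have [e|e] := eqVneq u1 v1.
  have [e'|e'] := eqVneq v2 (u2 + 1); first by exists (true, true); rewrite /nb /= e e'.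
  by exists (true, false); rewrite /nb /= e; congr pair; lia.
have [e'|e'] := eqVneq v1 (u1 + 1); first by exists (false, true); rewrite /nb /= e'; congr pair; lia.
by exists (false, false); rewrite /nb /=; congr pair; lia.
Qed.

Lemma is_bond_bond_set k : is_bond (bond_set k).
Proof. by apply/asboolP; exists k.1, (nb k.1 (k.2, true)); split => //; apply/norm1_nb; eexists. Qed.

(** Bonds are unordered pairs in the model, but pairs of a left or lower end and an orientation in
    the computations. This is a bijection, so averages transfer by [avg_relabel]. *)
Definition encode (a : index) : element :=
  match a with
  | inl x => inl x
  | inr k => inr (exist _ (bond_set k) (is_bond_bond_set k))
  end.

Lemma bond_set_ed x d : exists2 k, ed x d = inr k & bond_set k = [fset x; nb x d]%fset.
Proof.
case: d => v []; first by exists (x, v).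
exists (nb x (v, false), v) => //.
have e : nb (nb x (v, false)) (v, true) = x := nbK x (v, false).
by rewrite -[LHS]/([fset nb x (v, false); nb (nb x (v, false)) (v, true)]%fset) e fsetUC.
Qed.

Lemma fset2_eq (T : choiceType) (x y u v : T) : [fset x; y]%fset = [fset u; v]%fset ->
  (x = u /\ y = v) \/ (x = v /\ y = u).
Proof.
move=> /fsetP e; have hx := e x; have ey := e y; have eu := e u; have ev := e v.
move: hx ey eu ev; rewrite !inE !eqxx /= !orbT.
move=> /esym/orP[/eqP ->|/eqP ->] /esym/orP[/eqP ->|/eqP ->];
  rewrite ?orbb; (try by [left|right|left|right]); move=> /eqP h1 /eqP h2;
  by [left|right].
Qed.

Lemma bond_set_inj : injective bond_set.
Proof.
move=> [[x1 x2] v] [[y1 y2] v'] /fset2_eq.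
case: v v' => [] [] /= [[[e1 e2] e]|[[e1 e2] e]];
  move: (congr1 fst e) (congr1 snd e) => /= h1 h2; (try by exfalso; lia);
  by congr (pair (pair _ _) _); lia.
Qed.

Lemma bond_set_surj (e : bond) : exists k, val e = bond_set k.
Proof.
case: e => e /= /asboolP[u [v [-> /norm1_nb[d ->]]]].
by have [k _ <-] := bond_set_ed u d; exists k.
Qed.

Definition decode (a : element) : index :=
  match a with
  | inl x => inl x
  | inr e => inr (projT1 (cid (bond_set_surj e)))
  end.

Lemma decodeK : cancel decode encode.
Proof.
case=> [//|e] /=; case: cid => k ek /=; congr inr; apply: val_inj; by rewrite /= -ek.
Qed.

Lemma encodeK : cancel encode decode.
Proof.
case=> [//|k] /=; case: cid => k' /= ek; congr inr; exact/esym/bond_set_inj.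
Qed.

Lemma bond_open_linked (w : configuration) x y :
  bond_open w x y <-> linked (w \o encode) x y.
Proof.
split=> [[e [ev we]]|[d [-> wd]]].
  have [k ek] := bond_set_surj e.
  have ee : e = exist _ (bond_set k) (is_bond_bond_set k) by apply: val_inj.
  have wk : (w \o encode) (ed k.1 (k.2, true)) by rewrite /= -surjective_pairing -ee.
  have : [fset x; y]%fset = [fset k.1; nb k.1 (k.2, true)]%fset by rewrite -ev ek.
  move=> /fset2_eq[[-> ->]|[-> ->]]; first by exists (k.2, true).
  by apply: linked_sym; exists (k.2, true).
have [k ke kx] := bond_set_ed x d; move: wd; rewrite ke /= => wd.
by exists (exist _ (bond_set k) (is_bond_bond_set k)).
Qed.

Variable N : nat.
Hypothesis N0 : (0 < N)%N.

Let path_to (w : configuration) (u : site) := exists k (x : nat -> site),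
  [/\ x 0%N = 0, x k.+1 = u, (forall i, (1 <= i <= k)%N -> site_open w (x i)) &
     (forall i, (i <= k)%N -> bond_open w (x i) (x i.+1))].

Lemma joined_connected (w : configuration) :
  joined N (w \o encode) -> connected_to (sphere N) w.
Proof.
move=> [v [vN jv]]; pose A := connected_to (sphere N) w.
have [//|[v0|[]]] : A \/ v = 0 \/ ((dist 0%R v < N)%N /\ path_to w v); last first.
- by rewrite vN ltnn.
- by move: N0; rewrite -vN v0 distxx.
(* [path_to] requires at least one bond and open inner sites. Hence the origin is a separate case,
   from which the path restarts whenever the walk returns there, and the construction ends as soon
   as the sphere is reached. *)
pose I u := A \/ u = 0 \/ ((dist 0%R u < N)%N /\ path_to w u).
apply: (reach_inv (I := I)) jv; first by right; left.
move=> u u' _ Iu [uu uu' l].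
have fin : path_to w u' -> I u'.
  move=> [k [x [x0 xk xs xb]]].
  have := usable_dist uu'; rewrite leq_eqVlt => /orP[/eqP uN|uN]; last first.
    by right; right; split => //; exists k, x.
  by left; exists k, x; split => //; rewrite /sphere /= xk norm1_dist.
case: Iu => [Aw|Iu]; first by left.
have bu : bond_open w u u' by apply/bond_open_linked.
have [u0|u0] := pselect (u = 0).
  apply: fin; exists 0%N, (fun i => if i is 0%N then 0 else u'); split => // [[|[]]|[|]] //=.
  by rewrite -u0.
case: Iu => [//|[uN [k [x [x0 xk xs xb]]]]].
apply: fin; exists k.+1, (fun i => if (i <= k.+1)%N then x i else u'); split => //=.
- by rewrite ltnn.
- move=> i /andP[i1 ik]; rewrite ik; have [->|ik'] := eqVneq i k.+1; last first.
    by apply: xs; rewrite i1 -ltnS ltn_neqAle ik' ik.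
  rewrite xk; case: uu => [//|uN'|[_ wu]]; first by rewrite uN' ltnn in uN.
  exact: wu.
move=> i ik; rewrite ik; have [->|ik'] := eqVneq i k.+1; first by rewrite ltnn xk.
have ik1 : (i <= k)%N by rewrite -ltnS ltn_neqAle ik' ik.
by rewrite ltnS ik1; exact: xb.
Qed.

(** The given path may leave the ball, where no site is usable, so it is cut at its first visit to
    the sphere; until then unit steps keep it in the open ball. *)
Lemma connected_joined (w : configuration) :
  connected_to (sphere N) w -> joined N (w \o encode).
Proof.
move=> [k [x [x0 xk xs xb]]].
have hit : exists m, (m <= k.+1)%N && (dist 0%R (x m) == N).
  by exists k.+1; rewrite leqnn /= -norm1_dist; apply/eqP; exact: xk.
case: (ex_minnP hit) => m /andP[mk /eqP xm] mmin.
have lk i : (i < m)%N -> linked (w \o encode) (x i) (x i.+1).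
  by move=> im; apply/bond_open_linked; apply: xb; lia.
have lt i : (i < m)%N -> (dist 0%R (x i) < N)%N.
  elim: i => [|i IH] im; first by rewrite x0 distxx.
  have [d [xd _]] := lk i (ltnW im); have := dist_nbl 0 (x i) d; rewrite -xd.
  have := IH (ltnW im).
  have : dist 0%R (x i.+1) != N.
    apply/negP => h; have := mmin i.+1; rewrite h andbT => /(_ (ltac:(lia))); lia.
  by lia.
have us i : (i <= m)%N -> usable N (w \o encode) (x i).
  rewrite leq_eqVlt => /orP[/eqP ->|im]; first exact: Or32.
  case: i im => [|i] im; first by rewrite x0; exact: Or31.
  by apply: Or33; split; [exact: lt|apply: xs; lia].
exists (x m); split => //.
have : (m <= m)%N by []; elim: {-2}m => [|i IH] im; first by rewrite x0; exact: reach_refl.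
apply: reach_step (IH (ltnW im)) _.
by split; [apply: us; exact: ltnW|exact: us|exact: lk].
Qed.

End Encoding.

(** * The product measure evaluated on events with finitely many coordinates *)

Section Cylinders.
Local Open Scope classical_set_scope.

Definition cylinder (K : {fset element}) (c : element -> bool) : set configuration :=
  [set w | forall a, a \in K -> w a = c a].

Lemma measurable_coordinate a v : measurable [set w : configuration | w a = v].
Proof.
have h : measurable [set w : configuration | w a = true].
  by apply: sub_sigma_algebra; exists a.
case: v => //; rewrite (_ : [set w | _] = ~` [set w : configuration | w a = true]).
  exact: measurableC.
by apply/seteqP; split => w /=; case: (w a).
Qed.

Lemma measurable_cylinder K c : measurable (cylinder K c).
Proof.
rewrite (_ : cylinder K c = \bigcap_(a in [set` K]) [set w : configuration | w a = c a]).
  by apply: fin_bigcap_measurable => // a _; exact: measurable_coordinate.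
by [].
Qed.

Variables (R : realType) (s b : R) (mu : probability configuration R).
Hypothesis hmu : is_mixed_bernoulli s b mu.

(** [K] holds the coordinates already prescribed by [c]. Moving a coordinate from [J] to [K] splits
    the cylinder in two; once [J] is empty, the event contains the cylinder or misses it.
    Measurability is carried along for the additivity of [mu]. *)
Lemma mixed_bernoulli_avg (A : set configuration) (J : seq element) (K : {fset element}) c :
  uniq J -> (forall a, a \in J -> a \notin K) ->
  (forall w w' : configuration, {in J, w =1 w'} -> {in K, w =1 w'} -> A w -> A w') ->
  measurable (A `&` cylinder K c) /\
  mu (A `&` cylinder K c) =
    ((\prod_(a <- K) (if c a then open_prob s b a else 1 - open_prob s b a)) *
     avg (open_prob s b) J (fun w => (`[< A w >])%:R) c)%:E.
Proof.
elim: J K c => [|a J IH] K c /=.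
  move=> _ _ hA; have [Ac|nAc] := pselect (A c).
    rewrite (_ : A `&` cylinder K c = cylinder K c).
      split; first exact: measurable_cylinder.
      by rewrite asboolT // mulr1 hmu.
    by apply/seteqP; split => [w []//|w wc]; split => //; apply: hA Ac => // d /wc.
  rewrite (_ : A `&` cylinder K c = set0).
    by rewrite asboolF // mulr0 measure0; split.
  by apply/seteqP; split => // w [Aw wc]; apply: nAc; apply: hA Aw.
move=> /andP[aJ uJ] JK hA.
have aK : a \notin K by apply: JK; rewrite mem_head.
have IH' v := IH (a |` K)%fset (upd c a v) uJ.
have dJ d : d \in J -> d \notin (a |` K)%fset.
  move=> dJ; rewrite !inE negb_or JK ?inE ?dJ ?orbT // andbT.
  by apply: contraNneq aJ => <-.
have hA' (w w' : configuration) : {in J, w =1 w'} -> {in (a |` K)%fset, w =1 w'} -> A w -> A w'.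
  move=> wJ wK; apply: hA => d.
    by rewrite inE => /orP[/eqP ->|/wJ//]; apply: wK; rewrite !inE eqxx.
  by move=> dK; apply: wK; rewrite !inE dK orbT.
have [m1 e1] := IH' true dJ hA'; have [m0 e0] := IH' false dJ hA'.
have AE : A `&` cylinder K c = (A `&` cylinder (a |` K)%fset (upd c a true)) `|`
    (A `&` cylinder (a |` K)%fset (upd c a false)).
  have cylE v w : cylinder (a |` K)%fset (upd c a v) w <-> w a = v /\ cylinder K c w.
    split=> [h|[wa h] d].
      split; first by rewrite h ?upd_same // !inE eqxx.
      move=> d dK; rewrite h ?upd_other // ?inE ?dK ?orbT //.
      by apply: contraNneq aK => <-.
    rewrite !inE => /orP[/eqP ->|dK]; first by rewrite upd_same.
    rewrite upd_other ?h //; by apply: contraNneq aK => <-.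
  apply/seteqP; split => [w [Aw wc]|w [[Aw /cylE[]]|[Aw /cylE[]]]] //.
  by case e : (w a); [left|right]; split => //; apply/cylE.
rewrite AE; split; first exact: measurableU.
have mU : mu ((A `&` cylinder (a |` K)%fset (upd c a true)) `|`
      (A `&` cylinder (a |` K)%fset (upd c a false))) =
    (mu (A `&` cylinder (a |` K)%fset (upd c a true)) +
     mu (A `&` cylinder (a |` K)%fset (upd c a false)))%E.
  apply: measureU => //; apply/seteqP; split => // w [[_ h1] [_ h0]]; move: (h1 a) (h0 a).
  by rewrite !upd_same !inE eqxx => /(_ isT) -> /(_ isT).
rewrite mU e1 e0 -EFinD; congr EFin.
have pE v : \prod_(d <- (a |` K)%fset)
      (if upd c a v d then open_prob s b d else 1 - open_prob s b d) =
    (if v then open_prob s b a else 1 - open_prob s b a) *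
    \prod_(d <- K) (if c d then open_prob s b d else 1 - open_prob s b d).
  rewrite big_fsetU1 //= upd_same; congr (_ * _).
  rewrite big_seq [RHS]big_seq; apply: eq_bigr => d dK; rewrite upd_other //.
  by apply: contraNneq aK => <-.
rewrite !pE /avg1; ring.
Qed.

Lemma theta_avg n : theta mu n =
  avg (mixed_weight s b) (mixed_indices n.+1) (ind R (joined n.+1)) zeroconf.
Proof.
set N := n.+1; pose J := map encode (mixed_indices N).
have joinedP (w : configuration) : connected_to (sphere N) w <-> joined N (w \o encode).
  by split; [exact: connected_joined|exact: joined_connected].
have uJ : uniq J.
  by rewrite map_inj_uniq ?uniq_mixed_indices //; exact: can_inj encodeK.
have hA (w w' : configuration) : {in J, w =1 w'} -> {in fset0, w =1 w'} ->
    connected_to (sphere N) w -> connected_to (sphere N) w'.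
  move=> ww' _ /joinedP jw; apply/joinedP; apply: contrapT => njw'.
  have := @joined_supported N R (w \o encode) (w' \o encode).
  rewrite ind1 // ind0 // => h.
  have /eqP := h (fun a aK => ww' _ (map_f encode aK)); by rewrite oner_eq0.
have J0 a : a \in J -> a \notin (fset0 : {fset element}) by [].
have [_ e] := mixed_bernoulli_avg (fun=> false) uJ J0 hA.
have -> : theta mu n = fine (mu (connected_to (sphere N) `&` cylinder fset0 (fun=> false))).
  rewrite /theta (_ : _ `&` _ = connected_to (sphere N)) //.
  by apply/seteqP; split => [w []|w].
rewrite e big_seq_fset0 mul1r /J (avg_relabel _ _ _ _ encodeK decodeK).
rewrite -[LHS]/(avg (open_prob s b \o encode) (mixed_indices N)
  (fun u => (`[< connected_to (sphere N) (u \o decode) >])%:R) zeroconf).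
have -> : open_prob s b \o encode = mixed_weight s b by apply/funext => -[].
congr (avg _ _ _ _); apply/funext => u; rewrite /ind; congr (nat_of_bool _)%:R.
apply: asbool_equiv_eq; rewrite joinedP.
by rewrite (_ : (u \o decode) \o encode = u) //; apply/funext => a /=; rewrite encodeK.
Qed.

End Cylinders.

(** A path to the larger sphere meets the smaller one. The convergence that follows lets [limn]
    inherit uniform lower bounds. *)
Lemma theta_nonincreasing (R : realType) (s b : R) (mu : probability configuration R) :
  0 <= s <= 1 -> 0 <= b <= 1 -> is_mixed_bernoulli s b mu ->
  nonincreasing_seq (theta mu).
Proof.
move=> s01 b01 hmu; apply/nonincreasing_seqP => n; rewrite !(theta_avg hmu).
set p := mixed_weight s b; pose K := mixed_indices n.+1 ++ mixed_indices n.+2.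
have h1 : supported (mixed_indices n.+1) (ind R (joined n.+1)) := joined_supported R.
have h2 : supported (mixed_indices n.+2) (ind R (joined n.+2)) := joined_supported R.
have k1 : supported K (ind R (joined n.+1)).
  by apply: supportedS h1 => a aK; rewrite mem_cat aK.
have k2 : supported K (ind R (joined n.+2)).
  by apply: supportedS h2 => a aK; rewrite mem_cat aK orbT.
rewrite (avg_supported p zeroconf zeroconf h1 k1) (avg_supported p zeroconf zeroconf h2 k2).
apply: avg_le; first exact: mixed_weightP.
move=> w; apply: ind_le => -[v [vN jv]].
have l1 : (dist 0%R 0%R <= n.+1)%N by rewrite distxx.
have l2 : (n.+1 <= dist 0%R v)%N by rewrite vN.
have [u [uN ju]] := reach_truncate jv l1 l2; exists u; split => //.
apply: reach_link_in_sub ju => z [[->|zN|[zN wz]]]; rewrite ?zN ?ltnn //.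
- by move=> _; exact: Or31.
- by rewrite leq_eqVlt => /orP[/eqP|] h; [exact: Or32|exact: Or33].
Qed.

(** The lower bound at (1, b0) is the same for all radii and positive because b0 > 1/2; it is
    carried along the curve and then passes to the limit. *)
Lemma supercritical_curve (R : realType) (P : R -> R -> probability configuration R)
    (hP : forall s b : R, 0 <= s <= 1 -> 0 <= b <= 1 -> is_mixed_bernoulli s b (P s b))
    (b0 b : R) : 1 / 2 < b0 < 1 -> b0 <= b -> b <= 1 ->
  supercritical P b (curve b0 b).
Proof.
move=> /andP[b02 b01] b0b b1; have s01 := curve01 b0b b1.
have b01' : 0 <= b <= 1 by lra.
have hmu := hP _ _ s01 b01'; split => //.
have lower n : 1 - 1 / (2 * b0) <= theta (P (curve b0 b) b) n.
  rewrite (theta_avg hmu).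
  have b0' : 0 <= b0 by lra.
  apply: le_trans (joined_curve_le n.+1 b0' b0b b1).
  have b00 : 0 <= b0 <= 1 by lra.
  apply: le_trans (parm_le_joined n.+1 b00).
  by apply: parm_lower => //; lra.
have c0 : 0 < 1 - 1 / (2 * b0) by rewrite subr_gt0 ltr_pdivrMr; lra.
apply: lt_le_trans c0 _; apply: limr_ge; last exact: nearW.
apply: nonincreasing_is_cvgn; first exact: theta_nonincreasing hmu.
by exists (1 - 1 / (2 * b0)) => _ [n _ <-].
Qed.

Lemma s_c_le (R : realType) (P : R -> R -> probability configuration R) (b s : R) :
  supercritical P b s -> s_c P b <= s.
Proof.
move=> hs; rewrite /s_c asboolF; last by move=> h; rewrite h in hs.
by apply: ge_inf => //; exists 0 => r [/andP[]].
Qed.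

Lemma s_c_le1 (R : realType) (P : R -> R -> probability configuration R) (b : R) :
  s_c P b <= 1.
Proof.
have [h|/set0P[s hs]] := eqVneq (supercritical P b) set0.
  by rewrite /s_c asboolT.
by apply: le_trans (s_c_le hs) _; case: hs => /andP[].
Qed.

Theorem corollaryA2 (R : realType)
    (P : R -> R -> probability configuration R)
    (hP : forall s b : R, 0 <= s <= 1 -> 0 <= b <= 1 ->
       is_mixed_bernoulli s b (P s b))
    (b : R) (hb : 0 <= b <= 1) :
  s_c P b <=
    expR (- (2 / 3) * (b - 1 / 2 + 1 / 3 * ln ((8 - 6 * b) / 5))).
Proof.
rewrite -/(rate b).
have rate_half : rate (1 / 2 : R) = 0.
  by rewrite /rate (_ : (8 - 6 * (1 / 2)) / 5 = 1 :> R) ?ln1; lra.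
(* For b <= 1/2 the exponent is nonnegative, so the bound is at least 1. *)
have [b_le|b_gt] := leP b (1 / 2).
  apply: le_trans (s_c_le1 P b) _; rewrite -[leLHS]expR0 ler_expR.
  by have := rate_le b_le (ltac:(lra)); lra.
rewrite leNgt; apply/negP => lt_sc; have sc0 := lt_trans (expR_gt0 _) lt_sc.
(* [e] is the supposed excess in logarithmic scale. The curve from (1, b0) forces e <= 2/3 *
   [rate b0], which a b0 close to 1/2 contradicts. *)
pose e := ln (s_c P b) + 2 / 3 * rate b.
have e0 : 0 < e.
  by move: lt_sc; rewrite -[X in _ < X]lnK ?posrE // ltr_expR /e; lra.
(* The midpoint keeps b0 strictly between 1/2 and b; the other term makes [rate b0] at most e. *)
pose b0 := Num.min ((1 / 2 + b) / 2) (1 / 2 + e).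
have b0_gt : 1 / 2 < b0 by rewrite /b0 lt_min; lra.
have b0_lt : b0 < b by rewrite /b0 gt_min; lra.
have b0_le : b0 <= 1 / 2 + e by rewrite /b0 ge_min lexx orbT.
(* The logarithm is nonpositive beyond 1/2; this explicit bound replaces the continuity of [rate] at
   1/2. *)
have rb0 : rate b0 <= b0 - 1 / 2.
  have : ln ((8 - 6 * b0) / 5) <= 0 by apply: ln_le0; lra.
  by rewrite /rate; lra.
have := s_c_le (supercritical_curve hP (b0 := b0) (b := b)
  (ltac:(lra)) (ltac:(lra)) (ltac:(lra))).
rewrite -[leLHS]lnK ?posrE // ler_expR => h.
by move: e0; rewrite /e in b0_le *; lra.
Qed.
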